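(* Let $r\geq 2$ be an integer, let $n$ be a positive integer, and let $c$ and $\varepsilon$ be real numbers satisfying $1/\ln n<c<r^{-8(r+21)(r+1)}$ and $0<\varepsilon<2^{-36}r^{-24}$. Let $G$ be a graph of order $n$. If $\mu(G)>(1-1/r-\varepsilon)n$, then $G$ satisfies at least one of the following conditions: (a) $G$ contains a subgraph isomorphic to $K_{r+1}\left(\lfloor c\ln n\rfloor,\ldots,\lfloor c\ln n\rfloor,\lceil n^{1-\sqrt{c}}\rceil\right)$, i.e., the complete $(r+1)$-partite graph with $r$ parts of size $\lfloor c\ln n\rfloor$ and one part of size $\lceil n^{1-\sqrt{c}}\rceil$; (b) $G$ differs from $T_r(n)$ in fewer than $\left(\varepsilon^{1/4}+c^{1/(8r+8)}\right)n^2$ edges.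
   Context: All graphs are finite and simple. $\mu(G)$ denotes the largest eigenvalue of the adjacency matrix of $G$. $K_{r}(s_1,\ldots,s_r)$ denotes the complete $r$-partite graph with parts of sizes $s_1,\ldots,s_r$. $T_r(n)$ denotes the $r$-partite Turán graph of order $n$, i.e., the complete $r$-partite graph on $n$ vertices whose part sizes differ by at most one. ''$G$ differs from $T_r(n)$ in fewer than $m$ edges'' means that $G$ can be transformed into a graph isomorphic to $T_r(n)$ (on the same vertex set) by adding and/or deleting fewer than $m$ edges in total. *)

(* Defs.v *)
From HB Require Import structures.
From mathcomp Require Import all_boot all_order all_algebra.
From mathcomp Require Import all_classical all_reals all_analysis.
Set Implicit Arguments. Unset Strict Implicit. Unset Printing Implicit Defensive.
Import Order.TTheory GRing.Theory Num.Theory.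
Local Open Scope ring_scope.

Definition simple_graph (n : nat) (e : rel 'I_n) : Prop :=
  (forall x y, e x y = e y x) /\ (forall x, ~~ e x x).

Definition adjmx (R : realType) (n : nat) (e : rel 'I_n) : 'M[R]_n :=
  \matrix_(i, j) (e i j)%:R.

Definition mu (R : realType) (n : nat) (e : rel 'I_n) : R :=
  sup [set a : R | eigenvalue (adjmx R e) a].

Definition contains_complete_multipartite (n k : nat) (e : rel 'I_n)
    (s : 'I_k -> nat) : Prop :=
  exists P : 'I_k -> {set 'I_n},
    (forall i, #|P i| = s i) /\
    (forall i j, i != j -> [disjoint P i & P j]) /\
    (forall i j x y, i != j -> x \in P i -> y \in P j -> e x y).

(* A graph on 'I_n given by a part assignment p : 'I_n -> 'I_r is the
   complete r-partite graph with parts p^-1(i); it is (isomorphic to)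
   the Turan graph T_r(n) iff the part sizes differ by at most one. *)
Definition balanced_partition (n r : nat) (p : 'I_n -> 'I_r) : Prop :=
  forall i j : 'I_r, (#|[set x | p x == i]| <= #|[set x | p x == j]| + 1)%N.

Definition edit_dist_partition (n r : nat) (e : rel 'I_n) (p : 'I_n -> 'I_r)
    : nat :=
  #|[set xy : 'I_n * 'I_n | (xy.1 < xy.2)%N && (e xy.1 xy.2 != (p xy.1 != p xy.2))]|.

Definition differs_from_Turan_lt (R : realType) (n r : nat) (e : rel 'I_n)
    (m : R) : Prop :=
  exists p : 'I_n -> 'I_r, balanced_partition p /\
    ((edit_dist_partition e p)%:R < m).

(* Main.v *)
(* Put q = c^(1/(8r+8)).  If G has at least q^7 n^(r+1) cliques of size r+1,
   then (a) holds: keep the r-cliques with at least (q^7/2) n extensions, find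
   by induction a logarithmic complete r-partite graph whose rows are such
   r-cliques, and apply the pigeonhole principle to the neighbourhoods of the
   vertices in the set of rows.  The induction loses only constant factors in
   the size, because it keeps track of a matching of cliques.

   Otherwise the Moon-Moser inequalities for weighted clique sums give an
   approximate Motzkin-Straus inequality: the edge sum of any spread-out
   probability weight is at most 1 - 1/r + o(1).  For the squared entries of an
   eigenvector it shows that G has edge density at least
   1 - 1/r - 2 eps - o(1); for a perturbation of the uniform weight it shows
   that the degrees have variance at most 2 eps + o(1).  By averaging there is
   an r-clique K of vertices of almost average degree, with few common
   neighbours, and such that the common neighbourhoods of its (r-1)-subsets
   span few edges.  Almost every vertex has exactly one non-neighbour in K, and
   this non-neighbour defines the required partition. *)
Require Import Defs.
From HB Require Import structures.
From mathcomp Require Import all_classical all_reals all_analysis.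
(* Imported last, for the lemma names of finset to shadow those of classical_sets. *)
From mathcomp Require Import all_boot all_order all_algebra.
From mathcomp Require Import fingroup perm zify ring lra.
Set Implicit Arguments.
Unset Strict Implicit.
Unset Printing Implicit Defensive.
Import Order.TTheory GRing.Theory Num.Theory.
Local Open Scope ring_scope.

(** * Weighted clique sums *)

(** Lagrange's identity: twice the difference of the two sides is a double sum of weighted
    squares. *)
Lemma sum_cauchy_schwarz (R : realFieldType) (I : finType) (P : pred I)
    (w f g : I -> R) : (forall i, 0 <= w i) ->
  (\sum_(i | P i) w i * (f i * g i)) ^+ 2
  <= (\sum_(i | P i) w i * f i ^+ 2) * (\sum_(i | P i) w i * g i ^+ 2).
Proof.
move=> w0.
have : 0 <= \sum_(i | P i) \sum_(j | P j)
    w i * w j * (f i * g j - f j * g i) ^+ 2.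
  apply: sumr_ge0 => i _; apply: sumr_ge0 => j _.
  by apply: mulr_ge0; [exact: mulr_ge0|exact: sqr_ge0].
suff -> : \sum_(i | P i) \sum_(j | P j) w i * w j * (f i * g j - f j * g i) ^+ 2
  = 2 * ((\sum_(i | P i) w i * f i ^+ 2) * (\sum_(i | P i) w i * g i ^+ 2)
         - (\sum_(i | P i) w i * (f i * g i)) ^+ 2).
  by rewrite pmulr_rge0 ?ltr0n // subr_ge0.
have E (u v : I -> R) : (\sum_(i | P i) u i) * (\sum_(i | P i) v i)
    = \sum_(i | P i) \sum_(j | P j) u i * v j.
  by rewrite mulr_suml; apply: eq_bigr => i _; rewrite mulr_sumr.
rewrite expr2 mulrBr mulr_natl mulr2n.
rewrite {2}[(\sum_(i | P i) w i * f i ^+ 2) * _]mulrC !E.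
rewrite mulr_sumr -big_split -sumrB; apply: eq_bigr => i _.
rewrite mulr_sumr -big_split -sumrB; apply: eq_bigr => j _ /=.
by ring.
Qed.

Section WeightedCliques.
Variables (R : realFieldType) (T : finType) (e : rel T).
Hypotheses (e_sym : forall x y, e x y = e y x) (e_irr : forall x, ~~ e x x).

Definition clique (K : {set T}) : bool :=
  [forall x in K, forall y in K, (x != y) ==> e x y].

Definition kclique (k : nat) (K : {set T}) : bool := clique K && (#|K| == k).

Definition joined (K : {set T}) (x : T) : bool := [forall y in K, e x y].

Implicit Types w : T -> R.

Definition clique_sum (k : nat) w : R :=
  \sum_(K : {set T} | kclique k K) \prod_(x in K) w x.

Definition joined_sum w (K : {set T}) : R := \sum_(x | joined K x) w x.

Lemma cliqueP (K : {set T}) :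
  reflect {in K &, forall x y, x != y -> e x y} (clique K).
Proof.
apply: (iffP forall_inP) => [h x y xK yK xy|h x xK].
  by have /forall_inP/(_ y yK)/implyP/(_ xy) := h x xK.
by apply/forall_inP => y yK; apply/implyP => xy; apply: h.
Qed.

Lemma joinedP (K : {set T}) x :
  reflect {in K, forall y, e x y} (joined K x).
Proof. exact: forall_inP. Qed.

Lemma joined_notin (K : {set T}) x : joined K x -> x \notin K.
Proof. by move=> /joinedP h; apply/negP => /h; rewrite (negbTE (e_irr x)). Qed.

Lemma kclique_setU1 k (K : {set T}) x :
  kclique k K -> joined K x -> kclique k.+1 (x |: K).
Proof.
move=> /andP[/cliqueP cK /eqP sK] xK; apply/andP; split; last first.
  by rewrite cardsU1 (joined_notin xK) sK.
apply/cliqueP => y z /setU1P[->|yK] /setU1P[->|zK] yz.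
- by rewrite eqxx in yz.
- exact: (joinedP _ _ xK).
- by rewrite e_sym; exact: (joinedP _ _ xK).
- exact: cK.
Qed.

Lemma kclique_setD1 k (K : {set T}) x :
  kclique k.+1 K -> x \in K -> kclique k (K :\ x).
Proof.
move=> /andP[/cliqueP cK /eqP sK] xK; apply/andP; split.
  by apply/cliqueP => y z /setD1P[_ yK] /setD1P[_ zK]; exact: cK.
by rewrite (cardsD1 x) xK in sK; rewrite -eqSS -sK.
Qed.

Lemma joined_setD1 k (K : {set T}) x :
  kclique k K -> x \in K -> joined (K :\ x) x.
Proof.
move=> /andP[/cliqueP cK _] xK; apply/joinedP => y /setD1P[yx yK].
by apply: cK; rewrite // eq_sym.
Qed.

(** Double counting: a (k+1)-clique with a marked vertex [x] is a k-clique together with a vertex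
    joined to all of it. *)
Lemma sum_kcliqueS k (G : {set T} -> T -> R) :
  \sum_(K | kclique k.+1 K) \sum_(x in K) G (K :\ x) x
  = \sum_(K | kclique k K) \sum_(x | joined K x) G K x.
Proof.
rewrite (pair_big_dep (kclique k.+1) (fun K x => x \in K) (fun K x => G (K :\ x) x)).
rewrite (pair_big_dep (kclique k) joined) /=.
rewrite (reindex_onto (fun p : {set T} * T => (p.2 |: p.1, p.2))
   (fun p : {set T} * T => (p.1 :\ p.2, p.2))) /=; last first.
  by move=> [K x] /= /andP[_ xK]; rewrite setD1K.
apply: eq_big => [[K x]|[K x]] /=; last first.
  by move=> /andP[_ /eqP[->]].
apply/idP/idP => [/andP[/andP[cK xK] /eqP[eK]]|/andP[cK xK]].
  by rewrite -eK (kclique_setD1 cK xK) (joined_setD1 cK xK).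
rewrite (kclique_setU1 cK xK) setU11 /=; apply/eqP; congr pair.
by rewrite setU1K // joined_notin.
Qed.

Lemma clique_sumS k w :
  k.+1%:R * clique_sum k.+1 w
  = \sum_(K | kclique k K) (\prod_(x in K) w x) * joined_sum w K.
Proof.
under [RHS]eq_bigr => K _ do rewrite mulr_sumr.
rewrite -(sum_kcliqueS k (fun K x => (\prod_(y in K) w y) * w x)) mulr_sumr.
apply: eq_bigr => K /andP[_ /eqP sK].
rewrite [RHS](eq_bigr (fun=> \prod_(x in K) w x)); last first.
  by move=> x xK; rewrite mulrC -big_setD1.
by rewrite sumr_const sK mulr_natl.
Qed.

Lemma clique_sum_ge0 k w : (forall x, 0 <= w x) -> 0 <= clique_sum k w.
Proof. by move=> w0; apply: sumr_ge0 => K _; apply: prodr_ge0. Qed.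

Lemma clique_sum1E (G : {set T} -> R) :
  \sum_(K | kclique 1 K) G K = \sum_x G [set x].
Proof.
have := sum_kcliqueS 0 (fun _ x => G [set x]).
have c0 : \sum_(K | kclique 0 K) \sum_(x | joined K x) G [set x]
    = \sum_x G [set x].
  rewrite (big_pred1 set0) => [|K /=].
    by apply: eq_bigl => x; apply/joinedP => y; rewrite inE.
  rewrite /kclique cards_eq0; case: eqP => [->|]; last by rewrite andbF.
  by rewrite andbT; apply/cliqueP => x y; rewrite inE.
rewrite c0 => <-; apply: eq_bigr => K /andP[_ /cards1P[x ->]].
by rewrite big_set1.
Qed.

Lemma joined1 x y : joined [set x] y = e y x.
Proof.
apply/joinedP/idP => [h|h z /set1P ->//]; by apply: h; rewrite inE.
Qed.

Lemma clique_sum1 w : clique_sum 1 w = \sum_x w x.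
Proof.
by rewrite /clique_sum clique_sum1E; apply: eq_bigr => x _; rewrite big_set1.
Qed.

(** The quadratic form of the adjacency matrix, so every edge counts twice. *)
Definition edge_sum w : R := \sum_x w x * \sum_(y | e x y) w y.

Lemma clique_sum2 w : 2 * clique_sum 2 w = edge_sum w.
Proof.
rewrite (clique_sumS 1) clique_sum1E; apply: eq_bigr => x _.
rewrite big_set1; congr (_ * _); apply: eq_bigl => y.
by rewrite joined1 e_sym.
Qed.

(* A vertex outside the common neighbourhood of [K] is joined to [K :\ v] for
   at most one [v]. *)
Lemma joined_sum_setD1 k w (K : {set T}) :
  (forall x, 0 <= w x) -> #|K| = k.+1 ->
  \sum_(v in K) joined_sum w (K :\ v) <= \sum_x w x + k%:R * joined_sum w K.
Proof.
move=> w0 sK.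
have -> : \sum_(v in K) joined_sum w (K :\ v)
    = \sum_x w x *+ #|[set v in K | joined (K :\ v) x]|.
  rewrite /joined_sum (exchange_big_dep xpredT) //=; apply: eq_bigr => x _.
  by rewrite sumr_const; congr (_ *+ _); apply: eq_card => v; rewrite inE.
rewrite /joined_sum mulr_sumr [X in _ + X]big_mkcond -big_split /=.
apply: ler_sum => x _; case: ifPn => [jx|/forall_inPn[y yK xy]].
  rewrite mulr_natl -mulrS -sK; apply: ler_wpMn2l => //.
  by apply: subset_leq_card; apply/subsetP => v; rewrite inE => /andP[].
rewrite addr0 -[leRHS]mulr1n; apply: ler_wpMn2l => //.
rewrite -(cards1 y); apply: subset_leq_card; apply/subsetP => v.
rewrite !inE => /andP[vK /joinedP jv]; rewrite eq_sym.
by apply: contraNT xy => yv; apply: jv; rewrite !inE yv.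
Qed.

(** Cauchy-Schwarz over the k-cliques, applied to 1 and [joined_sum]; the resulting square is a sum
    over (k+1)-cliques, where [joined_sum_setD1] bounds it. *)
Lemma moon_moser k w : (forall x, 0 <= w x) -> \sum_x w x = 1 ->
  (k.+1%:R * clique_sum k.+1 w) ^+ 2
  <= clique_sum k w * (clique_sum k.+1 w + k%:R * (k.+2%:R * clique_sum k.+2 w)).
Proof.
move=> w0 w1; pose p (K : {set T}) := \prod_(x in K) w x.
have p0 K : 0 <= p K by apply: prodr_ge0.
have cs : (k.+1%:R * clique_sum k.+1 w) ^+ 2
    <= clique_sum k w * (\sum_(K | kclique k K) p K * joined_sum w K ^+ 2).
  have := @sum_cauchy_schwarz R _ (kclique k) p (fun=> 1) (joined_sum w) p0.
  rewrite clique_sumS /clique_sum.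
  under eq_bigr do rewrite mul1r.
  by under [X in _ <= X * _]eq_bigr do rewrite expr1n mulr1.
apply: (le_trans cs); apply: ler_wpM2l; first exact: clique_sum_ge0.
(* One of the two factors [joined_sum w K] is expanded; its vertex [x] enlarges [K] to a
   (k+1)-clique. *)
have -> : \sum_(K | kclique k K) p K * joined_sum w K ^+ 2
    = \sum_(K | kclique k.+1 K) p K * \sum_(v in K) joined_sum w (K :\ v).
  transitivity (\sum_(K | kclique k K) \sum_(x | joined K x)
      p K * w x * joined_sum w K).
    apply: eq_bigr => K _; rewrite -mulr_suml -mulr_sumr -/(joined_sum w K).
    by rewrite expr2 mulrA.
  rewrite -(sum_kcliqueS k (fun K x => p K * w x * joined_sum w K)).
  apply: eq_bigr => K _; rewrite mulr_sumr; apply: eq_bigr => v vK.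
  by congr (_ * _); rewrite /p mulrC -big_setD1.
rewrite clique_sumS mulr_sumr -big_split /=; apply: ler_sum => K /andP[_ /eqP sK].
rewrite -/(p K) -[X in X + _]mulr1 mulrCA -mulrDr.
by apply: ler_wpM2l => //; rewrite -[X in X + _]w1; exact: joined_sum_setD1.
Qed.

(** An approximate Motzkin-Straus inequality. If the edge sum exceeded the bound, with [th] its
    excess over [1 - 1/r], the Moon-Moser inequalities would bound each ratio of consecutive clique
    sums from below, and [clique_sum r.+1] would be too large. *)
Lemma edge_sum_le r w : (2 <= r)%N -> (forall x, 0 <= w x) -> \sum_x w x = 1 ->
  edge_sum w <= 1 - r%:R^-1 + r%:R ^+ (2 * r) * clique_sum r.+1 w.
Proof.
move=> r2 w0 w1; rewrite leNgt; apply/negP => hlt.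
set N : R := r%:R; pose F k := clique_sum k w.
have F0 k : 0 <= F k by exact: clique_sum_ge0.
have N2 : 2 <= N by rewrite /N ler_nat.
have N0 : 0 < N by lra.
pose th := edge_sum w - (1 - N^-1).
have th0 : N ^+ (2 * r) * F r.+1 < th by rewrite /th ltrBrDl.
have thp : 0 < th by apply: le_lt_trans th0; rewrite mulr_ge0 ?exprn_ge0 // ltW.
have cp k : (k <= r)%N -> 0 <= 1 - k%:R / N.
  by move=> kr; rewrite subr_ge0 ler_pdivrMr // mul1r ler_nat.
(* The induction starts at [k = 1] with equality, and Moon-Moser passes from [k] to [k + 1]. *)
have main k : (0 < k <= r)%N ->
    0 < F k /\ (1 - k%:R / N + k%:R * th) * F k <= k.+1%:R * F k.+1.
  elim: k => [//|k IH] /= kr.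
  case: k IH kr => [_ _|k IH kr].
    rewrite /F clique_sum2 clique_sum1 w1; split=> //.
    by rewrite /th mul1r mulr1 mul1r addrC subrK.
  have {IH} [Fk Fk1] := IH (ltnW kr).
  have c1 : 0 < 1 - k.+1%:R / N + k.+1%:R * th.
    by rewrite ltr_wpDl ?cp ?(ltnW kr) // mulr_gt0 ?ltr0n.
  have Fp : 0 < F k.+2.
    by rewrite -(pmulr_rgt0 _ (ltr0Sn R k.+1)); apply: lt_le_trans Fk1; rewrite mulr_gt0.
  split=> //.
  have mm := moon_moser k.+1 w0 w1; rewrite -!/(F _) in mm.
  set A := 1 - k.+1%:R / N + k.+1%:R * th in Fk1 c1.
  set Y := k.+3%:R * F k.+3 in mm *.
  have e1 : A * (k.+2%:R * F k.+2) <= F k.+2 + k.+1%:R * Y.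
    rewrite -(ler_pM2l Fk); apply: le_trans mm.
    rewrite [leRHS]expr2 mulrCA mulrA; apply: ler_wpM2r => //.
    by rewrite mulr_ge0.
  rewrite -(ler_pM2l (ltr0Sn R k)) -(lerD2l (F k.+2)); apply: le_trans e1.
  have -> : k.+2%:R = k.+1%:R + 1 :> R by rewrite -natr1.
  rewrite /A le_eqVlt; apply/orP; left; apply/eqP; field.
  by rewrite gt_eqF.
have Fge k : (k < r)%N -> N ^- (2 * k) <= F k.+1.
  elim: k => [_|k IH kr]; first by rewrite /F clique_sum1 w1 expr0 invr1.
  have [_ h] := main k.+1 (ltnW kr); have Fk := IH (ltnW kr).
  have : N^-1 * F k.+1 <= N * F k.+2.
    apply: le_trans (_ : k.+2%:R * F k.+2 <= _); last first.
      by apply: ler_wpM2r; rewrite ?F0 // ler_nat.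
    apply: le_trans h; apply: ler_wpM2r; first exact: F0.
    rewrite -[leLHS]addr0; apply: lerD; last by rewrite mulr_ge0 ?ltW.
    rewrite lerBrDr -[X in X + _]mul1r -mulrDl ler_pdivrMr // mul1r.
    by rewrite addrC natr1 ler_nat.
  rewrite ler_pdivrMl // mulrA -expr2 => h2.
  rewrite mulnS exprD invfM mulrC ler_pdivrMr ?exprn_gt0 //.
  by rewrite mulrC; apply: le_trans h2.
(* At [k = r] only [r * th] survives in the factor, which bounds [th] by the sum over
   (r+1)-cliques. *)
have := main r; rewrite leqnn andbT => /(_ (ltnW r2)) [_].
rewrite divff ?gt_eqF // subrr add0r => h.
have Fr : N ^- (2 * r.-1) <= F r by have := Fge r.-1; rewrite prednK ?(ltnW r2) //; apply.
have N2r : N ^+ (2 * r) = N ^+ 2 * N ^+ (2 * r.-1).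
  by rewrite -exprD; congr (_ ^+ _); lia.
have p0 : 0 < N ^+ (2 * r.-1) by rewrite exprn_gt0.
have Frp : 1 <= N ^+ (2 * r.-1) * F r.
  by rewrite -(ler_pM2l (x := N ^- (2 * r.-1))) ?invr_gt0 // mulr1 mulKf ?gt_eqF.
have h3 : N * th <= N * (N ^+ (2 * r) * F r.+1).
  apply: le_trans (_ : N ^+ (2 * r.-1) * ((r.+1)%:R * F r.+1) <= _); last first.
    rewrite N2r.
    have : r.+1%:R <= N ^+ 3.
      by rewrite /N -natrX ler_nat; nia.
    move=> /(ler_wpM2r (mulr_ge0 (ltW p0) (F0 r.+1))).
    by congr (_ <= _); ring.
  apply: le_trans (_ : N ^+ (2 * r.-1) * (N * th * F r) <= _); last first.
    by apply: ler_wpM2l => //; exact: ltW.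
  by rewrite mulrCA ler_peMr // mulr_ge0 ?ltW.
by move: h3; rewrite ler_pM2l // leNgt th0.
Qed.

End WeightedCliques.

(** * Many cliques force a large complete multipartite subgraph *)

Section ManyCliques.
Local Open Scope nat_scope.
Variables (T : finType) (e : rel T).
Hypothesis e_sym : forall x y, e x y = e y x.

(** Ordered tuples, possibly with repetitions, let the first coordinate be split off in the
    inductions. *)
Definition count_tuples (k : nat) (P : pred (seq T)) : nat :=
  \sum_(s : k.-tuple T) P s.

Lemma count_tuplesS k (P : pred (seq T)) :
  count_tuples k.+1 P = \sum_(s : k.-tuple T) #|[set v | P (v :: s)]|.
Proof.
under eq_bigr => s _ do rewrite -sum1dep_card big_mkcond /=.
rewrite exchange_big /= pair_bigA /=.
rewrite /count_tuples (reindex (fun p : T * k.-tuple T => [tuple of p.1 :: p.2])) /=.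
  by apply: eq_bigr => -[v s] _ /=; case: (P _).
exists (fun t : k.+1.-tuple T => (thead t, [tuple of behead t])) => [[v s] _|t _] /=.
  by rewrite theadE; congr pair; apply: val_inj.
by rewrite [t in RHS]tuple_eta; apply: val_inj.
Qed.

(* Vertices related to at least [m] indices are numerous; then apply the
   pigeonhole principle to their neighbourhoods in [I]. *)
Lemma popular_subset (I : finType) (A : I -> T -> bool) N m :
  0 < m -> 0 < N -> #|I| = 4 * N * m ->
  (forall i, #|T| <= 2 * N * #|[set v | A i v]|) ->
  exists S : {set I}, m <= #|S| /\
    #|T| <= 4 * N * 2 ^ #|I| * #|[set v | [forall i in S, A i v]]|.
Proof.
move=> m0 N0 sI hA.
pose nb v := [set i | A i v]; pose Q := [set v | m <= #|nb v|].
have dc : \sum_i #|[set v | A i v]| = \sum_v #|nb v|.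
  under eq_bigr => i _ do rewrite -sum1dep_card big_mkcond /=.
  rewrite exchange_big; apply: eq_bigr => v _.
  by rewrite /nb -sum1dep_card [RHS]big_mkcond.
have low : #|I| * #|T| <= 2 * N * \sum_v #|nb v|.
  rewrite -dc big_distrr /= -sum_nat_const; exact: leq_sum.
have up : \sum_v #|nb v| <= #|Q| * #|I| + #|T| * m.
  rewrite -!sum_nat_const [X in X + _]big_mkcond -big_split /=.
  apply: leq_sum => v _; rewrite inE; case: (leqP m #|nb v|) => h.
    exact: leq_trans (max_card _) (leq_addr _ _).
  by rewrite add0n ltnW.
(* Vertices related to fewer than [m] indices contribute at most half of the incidences forced by
   [low]. *)
have hQ : #|T| <= 4 * N * #|Q|.
  rewrite sI in low up.
  have : 4 * N * m * #|T| <= 4 * N * m * (4 * N * #|Q|) by nia.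
  by rewrite leq_pmul2l // !muln_gt0 N0 m0.
have cI : m <= #|[set: I]| by rewrite cardsT sI; nia.
pose f (S : {set I}) := #|[set v | nb v == S]|.
(* [S] is the most frequent neighbourhood among those with at least [m] elements; at most [2 ^ #|I|]
   sets compete. *)
case: (@arg_maxnP _ [set: I] (fun S => m <= #|S|) f cI) => S mS Smax.
exists S; split=> //.
have QE : #|Q| = \sum_(S : {set I} | m <= #|S|) f S.
  rewrite /f /Q -sum1dep_card (partition_big nb (fun S : {set I} => m <= #|S|)) //=.
  apply: eq_bigr => U mU; rewrite -sum1dep_card; apply: eq_bigl => v.
  by case: eqP => [->|]; rewrite ?mU ?andbF.
have Qle : #|Q| <= 2 ^ #|I| * f S.
  rewrite QE; apply: leq_trans (_ : \sum_(U : {set I} | m <= #|U|) f S <= _).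
    by apply: leq_sum => U mU; apply: Smax.
  rewrite sum_nat_cond_const leq_mul2r; apply/orP; right.
  rewrite -(cardsT I) -card_powerset; apply: subset_leq_card.
  by apply/subsetP => U _; rewrite powersetE subsetT.
apply: (leq_trans hQ); rewrite -(mulnA (4 * N)) leq_mul2l; apply/orP; right.
apply: (leq_trans Qle); rewrite leq_mul2l; apply/orP; right.
apply: subset_leq_card; apply/subsetP => v; rewrite !inE => /eqP <-.
by apply/forall_inP => i; rewrite inE.
Qed.

(* The columns of [C] are the parts of a complete k-partite graph. *)
Definition rows (x0 : T) (k m : nat) (C : 'I_m -> seq T) : Prop :=
  [/\ forall i, size (C i) = k,
      forall i i' j j', j < k -> j' < k -> j != j' ->
        e (nth x0 (C i) j) (nth x0 (C i') j')
    & forall j, j < k -> injective (fun i => nth x0 (C i) j)].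

(** A subfamily of rows is again a family of rows, so [popular_subset] can trade the factor [4 * N]
    in the number of rows for a large set [V] of common extensions. *)
Lemma rows_extend x0 k N m (P : pred (seq T)) (C : 'I_(4 * N * m) -> seq T) :
  0 < m -> 0 < N -> rows x0 k C ->
  (forall i, #|T| <= 2 * N * #|[set v | P (v :: C i)]|) ->
  exists (D : 'I_m -> seq T) (V : {set T}),
    [/\ rows x0 k D, forall i v, v \in V -> P (v :: D i)
      & #|T| <= 4 * N * 2 ^ (4 * N * m) * #|V|].
Proof.
move=> m0 N0 [sC adjC injC] hC.
have [|S [mS hS]] := @popular_subset 'I_(4 * N * m) (fun i v => P (v :: C i)) N m m0 N0 _ hC.
  by rewrite card_ord.
pose f (i : 'I_m) : 'I_(4 * N * m) := enum_val (widen_ord mS i).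
have fS i : f i \in S by exact: enum_valP.
have finj : injective f.
  by move=> i j /enum_val_inj /(congr1 val) /= /val_inj.
exists (C \o f), [set v | [forall i in S, P (v :: C i)]]; split.
- split=> [i|i i' j j'|j jk i i' /injC].
  + exact: sC.
  + exact: adjC.
  + by move=> /(_ jk) /finj.
- by move=> i v; rewrite inE => /forall_inP; apply.
- by rewrite card_ord in hS.
Qed.

(** Number of rows required at the bottom of the induction: each added column turns [N] into [2 * N]
    and [m] into [4 * N * m]. *)
Fixpoint rows_bound (k N m : nat) : nat :=
  if k is k'.+1 then rows_bound k' (2 * N) (4 * N * m) else m.

Lemma rows_bound_ge k N m : 0 < N -> m <= rows_bound k N m.
Proof.
elim: k N m => [//|k IH] N m N0 /=.
by apply: leq_trans (IH _ _ _); nia.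
Qed.

Lemma rows_bound_le k N m : rows_bound k N m <= (2 ^ (k + 2) * N) ^ k * m.
Proof.
elim: k N m => [|k IH] N m /=; first by rewrite mul1n.
apply: leq_trans (IH _ _) _; rewrite expnSr mulnA leq_mul2r; apply/orP; right.
rewrite leq_mul //; last by rewrite leq_mul2r addn2 (@leq_exp2l 2 2) ?orbT.
by rewrite mulnA -expnSr addSn.
Qed.

(** Tuples with fewer than [#|T| / (2 * N)] extensions account for at most half of the guaranteed
    number, and each other tuple has at most [#|T|] extensions. *)
Lemma count_tuples_popular k N (P : pred (seq T)) :
  0 < #|T| -> #|T| ^ k.+1 <= N * count_tuples k.+1 P ->
  #|T| ^ k <= 2 * N * count_tuples k (fun s => #|T| <= 2 * N * #|[set v | P (v :: s)]|).
Proof.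
move=> T0; rewrite count_tuplesS => h.
set c := count_tuples k _.
have up : 2 * N * \sum_(s : k.-tuple T) #|[set v | P (v :: s)]|
    <= 2 * N * #|T| * c + #|T| ^ k.+1.
  rewrite /c /count_tuples !big_distrr /= expnSr -{1}(card_tuple k T) -sum_nat_const.
  rewrite -big_split /=; apply: leq_sum => s _.
  case: (leqP #|T| (2 * N * _)) => h1.
    rewrite muln1; apply: leq_trans (leq_addr _ _).
    by rewrite leq_mul2l max_card orbT.
  by rewrite muln0 add0n ltnW.
rewrite -(leq_pmul2l T0) -expnS; nia.
Qed.

(** The induction hypothesis is applied to the predicate of having many extensions in [P];
    [rows_extend] then yields a set [V] of vertices extending all the chosen rows, and [m] of them
    form the new column. *)
Lemma rows_exist x0 k N m (P : pred (seq T)) :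
  0 < m -> 0 < N ->
  (forall s, size s = k -> P s -> pairwise e s) ->
  #|T| ^ k <= N * count_tuples k P ->
  4 ^ rows_bound k N m <= #|T| ->
  exists C : 'I_m -> seq T, rows x0 k C /\ forall i, P (C i).
Proof.
elim: k N m P => [|k IH] N m P m0 N0 cP hP bd.
  exists (fun=> [::]); split; first by split.
  move=> _; move: hP; rewrite /count_tuples expn0.
  case PE: (P [::]) => //; rewrite big1 ?muln0 // => s _.
  by rewrite tuple0 /= PE.
have T0 : 0 < #|T| by rewrite (leq_trans _ bd) // expn_gt0.
have hP' := count_tuples_popular T0 hP.
have [| | |C [rC hC]] := IH (2 * N) (4 * N * m) _ _ _ _ hP' bd.
- by rewrite !muln_gt0 N0 m0.
- by rewrite muln_gt0 N0.
- move=> s sk; case: (set_0Vmem [set v | P (v :: s)]) => [-> |[v]].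
    by rewrite cards0 muln0 leqNgt T0.
  rewrite inE => Pvs _.
  have := cP (v :: s); rewrite /= sk => /(_ erefl Pvs).
  by case/andP.
have [D [V [[sD adjD injD] hV cV]]] := rows_extend m0 N0 rC hC.
(* With [M = 4 * N * m], the chain [#|T| >= 4 ^ M >= M * 2 ^ M] leaves at least [m] vertices in
   [V]. *)
have mV : m <= #|V|.
  have b1 : 4 * N * m <= rows_bound k (2 * N) (4 * N * m).
    by apply: rows_bound_ge; rewrite muln_gt0 N0.
  set M := 4 * N * m in b1 cV.
  have b2 : M * 2 ^ M <= #|T|.
    apply: leq_trans bd; apply: leq_trans (_ : 4 ^ M <= _).
      by rewrite (expnMn 2 2) leq_mul2r ltnW ?orbT // ltn_expl.
    by rewrite leq_exp2l.
  have p0 : 0 < 4 * N * 2 ^ M by rewrite !muln_gt0 N0 expn_gt0.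
  rewrite -(leq_pmul2l p0); apply: leq_trans cV; apply: leq_trans b2.
  by rewrite /M; nia.
pose v (i : 'I_m) := enum_val (widen_ord mV i).
have vV i : v i \in V by exact: enum_valP.
have vinj : injective v by move=> i j /enum_val_inj /(congr1 val) /= /val_inj.
have vD i i' j : j < k -> e (v i) (nth x0 (D i') j).
  move=> jk; have := cP (v i :: D i'); rewrite /= sD => /(_ erefl (hV _ _ (vV i))).
  by case/andP => /all_nthP -> //; rewrite sD.
exists (fun i => v i :: D i); split; last by move=> i; exact: hV.
split=> [i|i i' [|j] [|j'] //= jk jk' jj'|[|j] jk i i' //=].
- by rewrite /= sD.
- exact: vD.
- by rewrite e_sym; exact: vD.
- exact: adjD.
- exact: vinj.
- exact: injD.
Qed.

Lemma card_kclique_le_tuples k :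
  #|[set K | kclique e k K]| <= count_tuples k (pairwise e).
Proof.
case: (set_0Vmem [set K | kclique e k K]) => [->|[K0 _]]; first by rewrite cards0.
have -> : count_tuples k (pairwise e) = #|[set s : k.-tuple T | pairwise e s]|.
  by rewrite -sum1dep_card big_mkcond; apply: eq_bigr => s _; case: pairwise.
case: k => [|k].
  apply: (@leq_trans #|[set (set0 : {set T})]|).
    apply: subset_leq_card; apply/subsetP => K; rewrite !inE => /andP[_].
    by rewrite cards_eq0.
  rewrite cards1 card_gt0; apply/set0Pn; exists [tuple].
  by rewrite inE.
case: (set_0Vmem [set: T]) => [T0|[x0 _]].
  rewrite [X in X <= _](_ : _ = 0) //; apply/eqP; rewrite cards_eq0 -subset0.
  apply/subsetP => K; rewrite inE => /andP[_ /eqP sK].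
  have : #|K| <= #|[set: T]| by rewrite subset_leq_card ?subsetT.
  by rewrite sK T0 cards0.
pose h (K : {set T}) : k.+1.-tuple T := insubd (nseq_tuple k.+1 x0) (enum K).
have hE K : kclique e k.+1 K -> val (h K) = enum K.
  by move=> /andP[_ /eqP sK]; rewrite val_insubd -cardE sK eqxx.
rewrite -(card_in_imset (f := h)); last first.
  move=> K L; rewrite !inE => cK cL /(congr1 val); rewrite !hE // => eKL.
  by apply/setP => x; rewrite -(mem_enum K) eKL mem_enum.
apply: subset_leq_card; apply/subsetP => s /imsetP[K]; rewrite !inE => cK ->.
rewrite hE //; case/andP: cK => /cliqueP cK _.
have := enum_uniq K; rewrite uniq_pairwise.
apply: (@sub_in_pairwise _ [in K]); last by apply/allP => x; rewrite mem_enum.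
by move=> x y xK yK; exact: cK.
Qed.

(** The first [r] parts come from rows with many extensions; the last part is cut out of the common
    extensions directly, which permits a size [t] much larger than [m]. *)
Lemma complete_multipartite_of_kcliques r N m t :
  0 < m -> 0 < N ->
  #|T| ^ r.+1 <= N * #|[set K | kclique e r.+1 K]| ->
  4 ^ rows_bound r (2 * N) (4 * N * m) <= #|T| ->
  4 * N * 2 ^ (4 * N * m) * t <= #|T| ->
  exists P : 'I_r.+1 -> {set T},
    (forall i, #|P i| = if i < r then m else t) /\
    (forall i j x y, i != j -> x \in P i -> y \in P j -> e x y).
Proof.
move=> m0 N0 hK bd ht.
have T0 : 0 < #|T| by rewrite (leq_trans _ bd) // expn_gt0.
have [x0 _] : exists x0, x0 \in T by apply/card_gt0P.
have hP : #|T| ^ r.+1 <= N * count_tuples r.+1 (pairwise e).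
  by apply: leq_trans hK _; rewrite leq_mul2l card_kclique_le_tuples orbT.
have hP' := count_tuples_popular T0 hP.
have [| | |C [rC hC]] := rows_exist x0 _ _ _ hP' bd.
- by rewrite !muln_gt0 N0 m0.
- by rewrite muln_gt0 N0.
- move=> s sk; case: (set_0Vmem [set v | pairwise e (v :: s)]) => [-> |[v]].
    by rewrite cards0 muln0 leqNgt T0.
  by rewrite inE => /andP[].
have [D [V [[sD adjD injD] hV cV]]] := rows_extend m0 N0 rC hC.
have tV : t <= #|V|.
  have p0 : 0 < 4 * N * 2 ^ (4 * N * m) by rewrite !muln_gt0 N0 expn_gt0.
  by rewrite -(leq_pmul2l p0); apply: leq_trans cV.
pose W := [set enum_val (widen_ord tV i) | i : 'I_t].
have WV x : x \in W -> x \in V by case/imsetP => i _ ->; exact: enum_valP.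
have vD x i j : x \in W -> j < r -> e x (nth x0 (D i) j).
  move=> /WV xV jr; case/andP: (hV i _ xV) => /all_nthP h _.
  by apply: h; rewrite sD.
exists (fun i : 'I_r.+1 => if i < r then [set nth x0 (D j) i | j : 'I_m] else W).
split=> [i|i j x y ij].
  case: ifP => ir; first by rewrite card_imset ?card_ord //; exact: injD.
  rewrite card_imset ?card_ord //.
  by move=> a b /enum_val_inj /(congr1 val) /= /val_inj.
have {}ij : val i != val j by [].
case: ifP => ir; case: ifP => jr.
- by case/imsetP => a _ -> /imsetP[b _ ->]; exact: adjD.
- by case/imsetP => a _ -> yW; rewrite e_sym; exact: vD.
- by move=> xW /imsetP[b _ ->]; exact: vD.
- move=> _ _; move: ij (ltn_ord i) (ltn_ord j); rewrite !ltnS.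
  by move: ir jr => /negbT + /negbT +; rewrite -!leqNgt /=; lia.
Qed.

End ManyCliques.

(** * Degrees and cliques of typical vertices *)

Section DegreesAndCliques.
Variables (R : realFieldType) (T : finType) (e : rel T).
Hypotheses (e_sym : forall x y, e x y = e y x) (e_irr : forall x, ~~ e x x).

Let n : R := #|T|%:R.

Definition degree (x : T) : R := #|[set y | e x y]|%:R.

Lemma degreeE x : degree x = \sum_(y | e x y) 1.
Proof. by rewrite sumr_const /degree; congr (_ *+ _); apply: eq_card => y; rewrite inE. Qed.

Lemma degree_le x : degree x <= n.
Proof. by rewrite ler_nat max_card. Qed.

Definition edge_density : R := edge_sum e (fun=> 1) / n ^+ 2.

Lemma sum_degree : \sum_x degree x = edge_sum e (fun=> 1 : R).
Proof. by apply: eq_bigr => x _; rewrite mul1r degreeE. Qed.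

(* Test the hypothesis on the weights [(1 + g x) / n], where [g] is the
   normalized deviation of the degree from its mean. *)
Lemma degree_variance (M : R) : 0 < n ->
  (forall w : T -> R, (forall x, 0 <= w x) -> (forall x, w x <= 5 / n) ->
     \sum_x w x = 1 -> edge_sum e w <= M) ->
  \sum_x (degree x / n - edge_density) ^+ 2 <= n * (M - edge_density).
Proof.
move=> n0 hM; have nn0 : n != 0 by rewrite gt_eqF.
have sumc (c : R) : \sum_(x : T) c = c * n by rewrite sumr_const -mulr_natr.
set D := edge_density; pose g x := degree x / n - D.
have sd : \sum_x degree x = D * n ^+ 2.
  by rewrite sum_degree /D /edge_density divfK // expf_neq0.
have sg : \sum_x g x = 0.
  by rewrite /g sumrB -mulr_suml sd sumc; field.
have d01 x : 0 <= degree x / n <= 1.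
  apply/andP; split; first by rewrite divr_ge0 ?ler0n // ltW.
  by rewrite ler_pdivrMr // mul1r degree_le.
have D01 : 0 <= D <= 1.
  have D0 : 0 <= D * n ^+ 2.
    by rewrite -sd; apply: sumr_ge0 => x _; exact: ler0n.
  have D1 : D * n ^+ 2 <= 1 * n ^+ 2.
    rewrite -sd mul1r expr2; apply: le_trans (_ : \sum_(x : T) n <= _).
      by apply: ler_sum => x _; exact: degree_le.
    by rewrite sumc.
  by move: D0 D1; rewrite pmulr_lge0 ?exprn_gt0 // ler_pM2r ?exprn_gt0 // => -> ->.
have g1 x : -1 <= g x <= 1.
  by rewrite /g; case/andP: (d01 x) => ? ?; case/andP: D01 => ? ?; apply/andP; split; lra.
pose w x := (1 + g x) / n.
have w0 x : 0 <= w x by apply: divr_ge0; [case/andP: (g1 x) => ? ?; lra|exact: ltW].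
have w5 x : w x <= 5 / n.
  by rewrite ler_pM2r ?invr_gt0 //; case/andP: (g1 x) => ? ?; lra.
have w1 : \sum_x w x = 1.
  by rewrite -mulr_suml big_split /= sg addr0 sumc mul1r divff.
have := hM w w0 w5 w1.
have E : edge_sum e w = n ^- 2 *
    \sum_x \sum_(y | e x y) (1 + g x + g y + g x * g y).
  rewrite /edge_sum mulr_sumr; apply: eq_bigr => x _; rewrite !mulr_sumr.
  by apply: eq_bigr => y _; rewrite /w; field.
have sq : \sum_x \sum_(y | e x y) g y ^+ 2 = \sum_x degree x * g x ^+ 2.
  rewrite (exchange_big_dep xpredT) //=; apply: eq_bigr => x _.
  by rewrite degreeE mulr_suml; apply: eq_big => [y|y _]; rewrite 1?e_sym ?mul1r.
have sy : \sum_x \sum_(y | e x y) g y = \sum_x degree x * g x.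
  rewrite (exchange_big_dep xpredT) //=; apply: eq_bigr => x _.
  by rewrite degreeE mulr_suml; apply: eq_big => [y|y _]; rewrite 1?e_sym ?mul1r.
have sx f : \sum_x \sum_(y | e x y) f x = \sum_x degree x * f x.
  by apply: eq_bigr => x _; rewrite degreeE mulr_suml; apply: eq_bigr => y _; rewrite mul1r.
(* Bounding [g x * g y] below by [- (g x ^+ 2 + g y ^+ 2) / 2] leaves only sums weighted by
   degrees. *)
have low : \sum_x \sum_(y | e x y) (1 + g x + g y - (g x ^+ 2 + g y ^+ 2) / 2)
    <= \sum_x \sum_(y | e x y) (1 + g x + g y + g x * g y).
  apply: ler_sum => x _; apply: ler_sum => y _.
  have := sqr_ge0 (g x + g y); nra.
have e1 : \sum_x \sum_(y | e x y) (1 + g x + g y - (g x ^+ 2 + g y ^+ 2) / 2)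
   = D * n ^+ 2 + 2 * \sum_x degree x * g x - \sum_x degree x * g x ^+ 2.
  transitivity (\sum_x \sum_(y | e x y) 1 + \sum_x \sum_(y | e x y) g x
      + \sum_x \sum_(y | e x y) g y
      - (\sum_x \sum_(y | e x y) g x ^+ 2 + \sum_x \sum_(y | e x y) g y ^+ 2) / 2).
    rewrite -!big_split mulr_suml -sumrB; apply: eq_bigr => x _ /=.
    by rewrite -!big_split mulr_suml -sumrB.
  rewrite sq sy (sx g) (sx (fun x => g x ^+ 2)) (sx (fun=> 1)).
  under eq_bigr do rewrite mulr1.
  by rewrite sd; field.
set V := \sum_x g x ^+ 2.
have e2 : \sum_x degree x * g x = n * V.
  have : \sum_x degree x * g x = \sum_x (n * g x ^+ 2 + n * D * g x).
    apply: eq_bigr => x _; have -> : degree x = n * (g x + D) by rewrite /g; field.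
    by ring.
  by rewrite big_split /= -!mulr_sumr sg mulr0 addr0.
(* The linear terms gain [2 * n * V], and the quadratic ones cost at most [n * V]. *)
have e3 : \sum_x degree x * g x ^+ 2 <= n * V.
  rewrite mulr_sumr; apply: ler_sum => x _.
  by apply: ler_wpM2r; [exact: sqr_ge0|exact: degree_le].
move: low; rewrite e1 e2 => low.
rewrite E => hE.
have : D * n ^+ 2 + n * V <= n ^+ 2 * M.
  rewrite -ler_pdivrMl ?exprn_gt0 //; apply: le_trans hE.
  by apply: ler_wpM2l; rewrite ?invr_ge0 ?sqr_ge0 //; apply: le_trans low; lra.
rewrite -/V => h; rewrite -(ler_pM2l n0); nra.
Qed.

(** Chebyshev's inequality for the degrees. *)
Lemma low_degree_card (M g : R) : 0 < n -> 0 < g ->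
  (forall w : T -> R, (forall x, 0 <= w x) -> (forall x, w x <= 5 / n) ->
     \sum_x w x = 1 -> edge_sum e w <= M) ->
  #|[set x | degree x < (edge_density - g) * n]|%:R * g ^+ 2
  <= n * (M - edge_density).
Proof.
move=> n0 g0 hM; apply: le_trans (degree_variance n0 hM).
set D := edge_density; set L := [set x | _].
rewrite (bigID (mem L)) /= -[leLHS]addr0; apply: lerD; last first.
  by apply: sumr_ge0 => x _; exact: sqr_ge0.
rewrite mulr_natl -sumr_const; apply: ler_sum => x; rewrite inE => h.
have : degree x / n < D - g by rewrite ltr_pdivrMr.
by move=> h1; rewrite -[leRHS]sqrrN; apply: lerXn2r; rewrite ?nnegrE; lra.
Qed.

Definition indicator (W : {set T}) (x : T) : R := (x \in W)%:R.

Lemma indicator_ge0 W x : 0 <= indicator W x.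
Proof. exact: ler0n. Qed.

Lemma prod_indicator W (K : {set T}) :
  \prod_(x in K) indicator W x = (K \subset W)%:R.
Proof.
case: (boolP (K \subset W)) => [/subsetP h|/subsetPn[x xK xW]].
  by rewrite big1 // => x /h; rewrite /indicator => ->.
by rewrite (bigD1 x) //= /indicator (negbTE xW) mul0r.
Qed.

Lemma card_nonneighbours x : #|[set y | ~~ e y x]|%:R = n - degree x.
Proof.
apply/eqP; rewrite eq_sym subr_eq -natrD eqr_nat addnC.
rewrite -(cardsC [set y | e x y]) eqn_add2l; apply/eqP.
by apply: eq_card => y; rewrite !inE e_sym.
Qed.

(** Each vertex of [K] excludes at most [n - d] vertices of [W]. *)
Lemma joined_sum_ge (W K : {set T}) (d : R) :
  (forall x, x \in K -> d <= degree x) ->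
  #|W|%:R - #|K|%:R * (n - d) <= joined_sum e (indicator W) K.
Proof.
move=> hd.
have h1 : \sum_(v in K) #|[set y | ~~ e y v]|%:R <= #|K|%:R * (n - d).
  rewrite mulr_natl -sumr_const; apply: ler_sum => v vK.
  by rewrite card_nonneighbours lerD2l lerN2 hd.
rewrite lerBlDr; apply: le_trans (_ : joined_sum e (indicator W) K
    + \sum_(v in K) #|[set y | ~~ e y v]|%:R <= _); last by rewrite lerD2l.
have -> : \sum_(v in K) #|[set y | ~~ e y v]|%:R
    = \sum_y #|[set v in K | ~~ e y v]|%:R :> R.
  rewrite -!natr_sum; congr _%:R.
  under eq_bigr do rewrite -sum1dep_card.
  rewrite (exchange_big_dep xpredT) //=; apply: eq_bigr => y _.
  by rewrite -sum1dep_card.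
rewrite /joined_sum [X in X + _]big_mkcond -big_split /= -sum1_card natr_sum.
rewrite big_mkcond; apply: ler_sum => x _; rewrite /indicator.
case: (x \in W); last by case: ifP => _; rewrite ?addr0 ?add0r ?ler0n.
case: ifPn => [_|/forall_inPn[v vK xv]]; first by rewrite lerDl ler0n.
rewrite add0r ler1n card_gt0; apply/set0Pn; exists v.
by rewrite inE vK.
Qed.

(** Greedy construction: a k-clique in [W] with [k < r] has at least [n / (2 * r)] extensions in
    [W], each larger clique arises at most [r] times, and [2 * r ^+ 2 <= r ^+ 4]. *)
Lemma clique_sum_indicator_ge (r : nat) (W : {set T}) (g : R) :
  (1 < r)%N -> 0 <= g -> r%:R * g <= (4 * r%:R)^-1 ->
  n - n / (4 * r%:R) <= #|W|%:R ->
  (forall x, x \in W -> (1 - r%:R^-1 - g) * n <= degree x) ->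
  n ^+ r <= (r%:R ^+ 4) ^+ r * clique_sum e r (indicator W).
Proof.
move=> r2 g0 hg cW hd; set F := fun k => clique_sum e k (indicator W).
have n0 : 0 <= n by exact: ler0n.
set N : R := r%:R in hg cW hd *.
have N2 : 2 <= N by rewrite ler_nat.
have N0 : N != 0 by rewrite gt_eqF //; lra.
have F0 k : 0 <= F k by apply: clique_sum_ge0; exact: indicator_ge0.
have step k : (k < r)%N -> n * F k <= N ^+ 4 * F k.+1.
  move=> kr; have kN : k.+1%:R <= N by rewrite ler_nat.
  have h1 : n / (2 * N) * F k <= k.+1%:R * F k.+1.
    rewrite /F clique_sumS // mulr_sumr; apply: ler_sum => K /andP[_ /eqP sK].
    rewrite prod_indicator; case: (boolP (K \subset W)) => KW; last by rewrite mulr0 mul0r.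
    rewrite mulr1 mul1r.
    apply: le_trans (joined_sum_ge W (fun x xK => hd x (subsetP KW x xK))).
    rewrite sK; apply: le_trans (lerB cW (lexx _)).
    have kg : k%:R * g <= (4 * N)^-1.
      by apply: le_trans hg; apply: ler_wpM2r => //; rewrite ler_nat ltnW.
    have kN' : k%:R / N <= 1 - N^-1.
      rewrite lerBrDr -[X in _ + X]mul1r -mulrDl ler_pdivrMr; last lra.
      by rewrite mul1r natr1.
    have e4 : (4 * N)^-1 = N^-1 / 4 by field.
    have -> : n / (2 * N) = n * (N^-1 / 2) by field.
    have -> : n - n / (4 * N) - k%:R * (n - (1 - N^-1 - g) * n)
      = n * (1 - N^-1 / 4 - k%:R / N - k%:R * g) by field.
    by apply: ler_wpM2l => //; move: kg; rewrite e4; lra.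
  have h2 : n / (2 * N) * F k <= N * F k.+1.
    by apply: le_trans h1 _; apply: ler_wpM2r.
  have -> : n * F k = 2 * N * (n / (2 * N) * F k) by field.
  apply: le_trans (_ : 2 * N * (N * F k.+1) <= _).
    by apply: ler_wpM2l => //; lra.
  rewrite mulrA; apply: ler_wpM2r => //.
  have -> : N ^+ 4 = N * N * (N * N) by ring.
  by rewrite -mulrA mulrC; apply: ler_wpM2l; nra.
suff main k : (k <= r)%N -> n ^+ k <= (N ^+ 4) ^+ k * F k by apply: main.
elim: k => [_|k IH kr].
  rewrite !expr0 mul1r /F /clique_sum (bigD1 set0) /=; last first.
    by rewrite /kclique cards0 eqxx andbT; apply/cliqueP => x y; rewrite inE.
  by rewrite big_set0 lerDl sumr_ge0 // => K _; rewrite prod_indicator ler0n.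
rewrite exprS [X in X * F _]exprSr -mulrA.
apply: le_trans (_ : (N ^+ 4) ^+ k * (n * F k) <= _).
  by rewrite mulrCA; apply: ler_wpM2l => //; apply: IH; exact: ltnW.
by apply: ler_wpM2l; [rewrite !exprn_ge0 //; lra|exact: step].
Qed.

(** Twice the number of edges spanned by the common neighbourhood of [L]. *)
Definition inner_edges (L : {set T}) : R :=
  \sum_(x | joined e L x) \sum_(y | joined e L y && e x y) 1.

(** Averaging over the r-cliques inside [W], whose number is [clique_sum e r (indicator W)]; both
    quantities are nonnegative, so their totals may be taken over all r-cliques. *)
Lemma good_clique (r : nat) (W : {set T}) :
  (0 < r)%N -> 0 < clique_sum e r (indicator W) ->
  exists K : {set T}, [/\ kclique e r K, K \subset W &
    (n * joined_sum e (fun=> 1) K + \sum_(v in K) inner_edges (K :\ v))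
      * clique_sum e r (indicator W)
    <= n * r.+1%:R ^+ 2 * clique_sum e r.+1 (fun=> 1)].
Proof.
move=> r0 Fp; set F := clique_sum e r (indicator W) in Fp *.
set k1 := clique_sum e r.+1 (fun=> 1).
pose Q K := n * joined_sum e (fun=> 1) K + \sum_(v in K) inner_edges (K :\ v).
have n0 : 0 <= n by exact: ler0n.
have js0 K : 0 <= joined_sum e (fun=> 1 : R) K by apply: sumr_ge0.
have in0 L : 0 <= inner_edges L by do 2![apply: sumr_ge0 => ? _].
have Q0 K : 0 <= Q K by rewrite addr_ge0 ?mulr_ge0 // sumr_ge0.
have s1 : \sum_(K | kclique e r K) joined_sum e (fun=> 1) K = r.+1%:R * k1.
  by rewrite clique_sumS //; apply: eq_bigr => K _; rewrite big1 // mul1r.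
(* An (r-1)-clique [L] arises from at most [n] pairs [K], [v]; with two adjacent common neighbours
   it forms an (r+1)-clique, obtained in [r * r.+1] ways. *)
have s2 : \sum_(K | kclique e r K) \sum_(v in K) inner_edges (K :\ v)
    <= n * (r%:R * (r.+1%:R * k1)).
  case: r r0 @F Fp @k1 s1 => [//|r] _ F Fp k1 s1.
  rewrite (sum_kcliqueS e_sym e_irr r (fun L _ => inner_edges L)).
  apply: le_trans (_ : \sum_(L | kclique e r L) n * inner_edges L <= _).
    apply: ler_sum => L _; rewrite sumr_const -mulr_natl; apply: ler_wpM2r => //.
    by rewrite ler_nat max_card.
  rewrite -mulr_sumr; apply: ler_wpM2l => //.
  have -> : \sum_(L | kclique e r L) inner_edges L
      = \sum_(L | kclique e r L) \sum_(x | joined e L x) joined_sum e (fun=> 1) (x |: L).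
    apply: eq_bigr => L _; apply: eq_bigr => x _; apply: eq_bigl => y.
    apply/andP/joinedP => [[/joinedP h xy] z /setU1P[->|/h //]|h].
      by rewrite e_sym.
    split; last by rewrite e_sym h // setU11.
    by apply/joinedP => z zL; apply: h; rewrite setU1r.
  rewrite -(sum_kcliqueS e_sym e_irr r (fun L x => joined_sum e (fun=> 1) (x |: L))).
  rewrite -s1 mulr_sumr; apply: ler_sum => K /andP[_ /eqP sK].
  rewrite (eq_bigr (fun=> joined_sum e (fun=> 1) K)); last first.
    by move=> v vK; rewrite setD1K.
  by rewrite sumr_const sK mulr_natl.
have tot : \sum_(K | kclique e r K) Q K <= n * r.+1%:R ^+ 2 * k1.
  rewrite big_split /= -mulr_sumr s1; apply: le_trans (lerD (lexx _) s2) _.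
  by rewrite -(natr1 r) le_eqVlt; apply/orP; left; apply/eqP; ring.
set B := n * r.+1%:R ^+ 2 * k1 in tot *.
have B0 : 0 <= B by apply: le_trans tot; apply: sumr_ge0.
case: (boolP [exists K : {set T}, [&& kclique e r K, K \subset W & Q K * F <= B]]).
  by case/existsP => K /and3P[cK KW hK]; exists K.
move=> /existsPn hno; exfalso.
have FE : F = \sum_(K | kclique e r K && (K \subset W)) 1.
  rewrite /F /clique_sum [RHS]big_mkcondr /=; apply: eq_bigr => K _.
  by rewrite prod_indicator; case: (K \subset W).
have [K0 cK0] : exists K, kclique e r K && (K \subset W).
  apply/existsP; apply: contraTT Fp => /existsPn h.
  by rewrite FE big_pred0 ?ltxx // => K; apply: negbTE.
have : B * F < F * \sum_(K | kclique e r K && (K \subset W)) Q K.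
  rewrite {1}FE !mulr_sumr; apply: ltr_sum.
    by apply/hasP; exists K0; rewrite ?mem_index_enum.
  move=> K /andP[cK KW]; rewrite mulr1 mulrC ltNge.
  by have := hno K; rewrite cK KW.
rewrite mulrC ltr_pM2l // ltNge => /negP; apply.
apply: le_trans tot; rewrite big_mkcondr; apply: ler_sum => K _.
by case: ifP.
Qed.

End DegreesAndCliques.

(** * Spectral radius and edge density *)

Section Spectral.
Variables (R : realFieldType) (m : nat) (e : rel 'I_m).
Hypothesis e_sym : forall x y, e x y = e y x.

(* Squares of the entries of an eigenvector, as in Wilf's and Nikiforov's
   applications of the Motzkin-Straus inequality. *)
Lemma eigenvalue_edge_sum (a : R) : 0 < a ->
  eigenvalue (\matrix_(i, j) (e i j)%:R : 'M[R]_m) a ->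
  exists w : 'I_m -> R,
    [/\ forall i, 0 <= w i, forall i, w i <= m%:R / a ^+ 2, \sum_i w i = 1
      & a ^+ 2 <= edge_sum e (fun=> 1) * edge_sum e w].
Proof.
move=> a0 /eigenvalueP[v va v0].
pose z (i : 'I_m) : R := `|v 0 i|.
have z0 i : 0 <= z i by exact: normr_ge0.
have az i : a * z i <= \sum_(j | e i j) z j.
  have /rowP/(_ i) := va; rewrite !mxE => h.
  rewrite /z -{1}(gtr0_norm a0) -normrM -h.
  apply: le_trans (ler_norm_sum _ _ _) _; rewrite [leRHS]big_mkcond.
  apply: ler_sum => j _; rewrite mxE e_sym; case: (e i j); last by rewrite mulr0 normr0.
  by rewrite mulr1.
pose S : R := \sum_i z i ^+ 2.
have S0 : 0 < S.
  have [i vi] : exists i, v 0 i != 0.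
    apply/existsP; apply: contraNT v0 => /existsPn h.
    by apply/eqP/rowP => i; rewrite mxE; apply/eqP; have := h i; rewrite negbK.
  rewrite /S (bigD1 i) //= ltr_pwDl ?sumr_ge0 // ?exprn_gt0 ?normr_gt0 //.
  by move=> j _; exact: sqr_ge0.
exists (fun i => z i ^+ 2 / S); split.
- by move=> i; rewrite divr_ge0 ?sqr_ge0 // ltW.
- move=> i; rewrite ler_pdivlMr ?exprn_gt0 // mulrAC ler_pdivrMr // -exprMn mulrC.
  (* Cauchy-Schwarz: there are at most [m] neighbours, and their squares sum to at most [S]. *)
  apply: le_trans (_ : (\sum_(j | e i j) z j) ^+ 2 <= _).
    apply: lerXn2r; rewrite ?nnegrE ?sumr_ge0 ?az //.
    by rewrite mulr_ge0 // ltW.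
  have := @sum_cauchy_schwarz R _ (e i) (fun=> 1) (fun=> 1) z (fun=> ler01).
  under eq_bigr do rewrite !mul1r.
  move=> h; apply: (le_trans h); apply: ler_pM.
  + by apply: sumr_ge0 => j _; rewrite mul1r sqr_ge0.
  + by apply: sumr_ge0 => j _; rewrite mul1r sqr_ge0.
  + under eq_bigr do rewrite mul1r expr1n.
    by rewrite sumr_const ler_nat -[leqRHS]card_ord max_card.
  + rewrite /S [leRHS](bigID (e i)) /= -[leLHS]addr0; apply: lerD.
      by under eq_bigr do rewrite mul1r.
    by apply: sumr_ge0 => j _; exact: sqr_ge0.
- by rewrite -mulr_suml divff // gt_eqF.
- have SS : S ^+ 2 != 0 by rewrite expf_neq0 // gt_eqF.
  have -> : edge_sum e (fun i => z i ^+ 2 / S)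
      = S ^- 2 * edge_sum e (fun i => z i ^+ 2).
    rewrite /edge_sum mulr_sumr; apply: eq_bigr => i _; rewrite !mulr_sumr.
    by apply: eq_bigr => j _; field; rewrite gt_eqF.
  rewrite mulrCA ler_pdivlMl ?exprn_gt0 // mulrC -exprMn.
  (* [a * S] is at most the sum of [z i * z j] over ordered adjacent pairs; Cauchy-Schwarz against
     the constant 1 splits off the number of these pairs. *)
  apply: le_trans (_ : (\sum_(p : 'I_m * 'I_m | e p.1 p.2) z p.1 * z p.2) ^+ 2 <= _).
    apply: lerXn2r; rewrite ?nnegrE.
    + by rewrite mulr_ge0 // ltW.
    + by apply: sumr_ge0 => p _; rewrite mulr_ge0.
    rewrite -(pair_big_dep xpredT e (fun i j => z i * z j)) /= /S mulr_sumr.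
    apply: ler_sum => i _; rewrite -mulr_sumr expr2 mulrCA.
    by apply: ler_wpM2l.
  have := @sum_cauchy_schwarz R _ (fun p : 'I_m * 'I_m => e p.1 p.2) (fun=> 1)
    (fun=> 1) (fun p => z p.1 * z p.2) (fun=> ler01).
  under eq_bigr do rewrite !mul1r.
  move=> h; apply: (le_trans h).
  rewrite -(pair_big_dep xpredT e (fun _ _ => 1 * 1 ^+ 2)) /=.
  rewrite -(pair_big_dep xpredT e (fun i j => 1 * (z i * z j) ^+ 2)) /=.
  rewrite le_eqVlt; apply/orP; left; apply/eqP; congr (_ * _).
    by apply: eq_bigr => i _; rewrite [RHS]mul1r mul1r expr1n.
  apply: eq_bigr => i _; rewrite mulr_sumr; apply: eq_bigr => j _.
  by rewrite mul1r exprMn.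
Qed.

End Spectral.

(** * From a clique to a balanced partition *)

Section BalancedPartitions.
Local Open Scope nat_scope.

(** Adding [r.-1 - i] before dividing makes the quotient jump exactly when a number congruent to [i]
    is passed. *)
Lemma card_modn_class n r i : i < r ->
  \sum_(x < n) (x %% r == i) = (n + (r.-1 - i)) %/ r.
Proof.
move=> ir; have r0 : 0 < r by apply: leq_ltn_trans ir.
elim: n => [|n IH]; first by rewrite big_ord0 add0n divn_small //; lia.
rewrite big_ord_recr /= IH addSn.
have E := divn_eq n r; set q := n %/ r in E; set t := n %% r in E *.
have tr : t < r by exact: ltn_pmod.
rewrite E.
have A k : q * r + t + k = q * r + (t + k) by rewrite addnA.
rewrite -addnS !A !divnMDl //.
case: (eqVneq t i) => [->|ti].
  have -> : i + (r.-1 - i) = r.-1 by lia.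
  have -> : i + (r.-1 - i).+1 = r by lia.
  by rewrite divnn r0 divn_small ?addn0 //; lia.
rewrite addn0; congr (_ + _).
case: (ltngtP t i) ti => // ti _.
  by rewrite !divn_small //; lia.
have -> : t + (r.-1 - i) = 1 * r + (t - i).-1 by lia.
have -> : t + (r.-1 - i).+1 = 1 * r + (t - i) by lia.
by rewrite !divnMDl // !divn_small //; lia.
Qed.

Definition balanced n r (p : 'I_n -> 'I_r) : bool :=
  [forall i, forall j, #|[set x | p x == i]| <= #|[set x | p x == j]| + 1].

Lemma balanced_exists n r : 0 < r -> exists p : {ffun 'I_n -> 'I_r}, balanced p.
Proof.
move=> r0; exists [ffun x : 'I_n => Ordinal (ltn_pmod x r0)].
have E (i : 'I_r) : #|[set x : 'I_n | [ffun x : 'I_n => Ordinal (ltn_pmod x r0)] x == i]|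
    = (n + (r.-1 - i)) %/ r.
  rewrite -(card_modn_class n (ltn_ord i)) -sum1dep_card big_mkcond.
  by apply: eq_bigr => x _; rewrite ffunE -val_eqE /=; case: eqP.
apply/forallP => i; apply/forallP => j; rewrite !E.
apply: leq_trans (_ : (n + r) %/ r <= _).
  by apply: leq_div2r; lia.
by rewrite divnDr ?dvdnn // divnn r0 leq_add2r; apply: leq_div2r; lia.
Qed.

Lemma balanced_perm n r (p : 'I_n -> 'I_r) (s : {perm 'I_n}) :
  balanced p -> balanced (p \o s).
Proof.
have E i : #|[set x | (p \o s) x == i]| = #|[set x | p x == i]|.
  rewrite -(card_imset [set x | (p \o s) x == i] (@perm_inj _ s)).
  apply: eq_card => y; apply/imsetP/idP => [[x]|].
    by rewrite !inE => h ->.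
  rewrite inE => h; exists (s^-1%g y); last by rewrite permKV.
  by rewrite inE /= permKV.
by move=> /forallP h; apply/forallP => i; apply/forallP => j; rewrite !E; exact: (forallP (h i) j).
Qed.

Lemma balanced_card n r (p : 'I_n -> 'I_r) i :
  balanced p -> n <= r * (#|[set x | p x == i]| + 1).
Proof.
move=> /forallP hp.
have {1}-> : n = \sum_(j < r) #|[set x | p x == j]|.
  rewrite -[LHS]card_ord -sum1_card (partition_big p xpredT) //=.
  by apply: eq_bigr => j _; rewrite -sum1dep_card.
apply: leq_trans (_ : \sum_(j < r) (#|[set x | p x == i]| + 1) <= _).
  by apply: leq_sum => j _; exact: (forallP (hp j) i).
by rewrite sum_nat_const card_ord.
Qed.

(* Take [p] balanced with the fewest disagreements with [c]: by swapping two
   values of [p], a class with a disagreement contains no foreign vertex. *)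
Lemma balanced_refinement n r (c : 'I_n -> option 'I_r) : 0 < r ->
  exists2 p : 'I_n -> 'I_r, balanced p &
    forall i, #|[set x | (c x == Some i) && (p x != i)]| = 0 \/
      #|[set x | (c x == Some i) && (p x != i)]| + #|[set x | p x == i]|
      = #|[set x | c x == Some i]|.
Proof.
move=> r0; have [p0 bp0] := balanced_exists n r0.
pose bad (p : {ffun 'I_n -> 'I_r}) := [set x | (c x != None) && (c x != Some (p x))].
case: (@arg_minnP _ p0 (fun p => balanced p) (fun p => #|bad p|) bp0) => p bp pmin.
exists p => // i; set M := [set x | _].
case: (set_0Vmem M) => [->|[x]]; first by left; rewrite cards0.
rewrite inE => /andP[/eqP cx px]; right.
suff sub : [set y | p y == i] \subset [set y | c y == Some i].
  rewrite -(cardsID [set y | p y == i] [set y | c y == Some i]) addnC.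
  congr (_ + _).
    by apply: eq_card => y; rewrite !inE; apply/idP/andP => [h|[]//]; split=> //;
      have /subsetP/(_ y) := sub; rewrite !inE; apply.
  by apply: eq_card => y; rewrite !inE andbC.
apply/subsetP => y; rewrite !inE => py; apply/negPn/negP => cy.
(* Swapping the values at [x] and [y] repairs [x]; since [c y] is not [Some i], no agreement is lost
   at [y]. *)
pose p' := [ffun z => p (tperm x y z)].
have bp' : balanced p'.
  have := balanced_perm (tperm x y) bp.
  move=> /forallP h; apply/forallP => k; apply/forallP => l.
  have E j : [set z | p' z == j] = [set z | (p \o tperm x y) z == j].
    by apply/setP => z; rewrite !inE ffunE.
  by rewrite !E; exact: (forallP (h k) l).
have := pmin _ bp'; rewrite leqNgt => /negP; apply; apply: proper_card.
apply/properP; split; last first.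
  exists x; first by rewrite inE cx /=; apply: contraNneq px => -[->].
  by rewrite inE cx ffunE tpermL (eqP py) eqxx.
apply/subsetP => z; rewrite !inE ffunE => /andP[-> /=].
case: tpermP => [->|->|//]; first by rewrite (eqP py) cx eqxx.
by rewrite (eqP py).
Qed.

End BalancedPartitions.

Section PartitionFromClique.
Variables (R : realFieldType) (n : nat) (e : rel 'I_n).
Hypothesis e_sym : forall x y, e x y = e y x.

Lemma natr_card_sum (T : finType) (P : pred T) :
  #|[set x | P x]|%:R = \sum_x (P x)%:R :> R.
Proof.
rewrite -sum1dep_card natr_sum big_mkcond; apply: eq_bigr => x _.
by case: (P x).
Qed.

Lemma clique_sum_card k :
  clique_sum e k (fun=> 1 : R) = #|[set K | kclique e k K]|%:R.
Proof.
rewrite natr_card_sum /clique_sum big_mkcond; apply: eq_bigr => K _.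
by case: (kclique e k K); rewrite // big1.
Qed.

(* The i-th class consists of the vertices whose only non-neighbour in [K] is
   the i-th vertex of [K]. *)
Lemma partition_of_clique (r : nat) (K : {set 'I_n}) (g : R) :
  (0 < n)%N -> (0 < r)%N -> 0 <= g -> kclique e r K ->
  (forall x, x \in K -> (1 - r%:R^-1 - g) * n%:R <= degree R e x) ->
  exists2 p : 'I_n -> 'I_r, balanced p &
    #|[set xy : 'I_n * 'I_n | e xy.1 xy.2 != (p xy.1 != p xy.2)]|%:R
    <= 2 * (\sum_(v in K) inner_edges R e (K :\ v)
            + 2 * n%:R * (2 * r%:R * g * n%:R
                          + 2 * joined_sum e (fun=> 1) K + r%:R))
       + n%:R ^+ 2 * (1 - r%:R^-1 - edge_density R e) + n%:R.
Proof.
move=> n0 r0 g0 cK hd; set N : R := n%:R; set I : R := \sum_(v in K) _.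
set s : R := joined_sum _ _ _.
have sK : #|K| = r by case/andP: cK => _ /eqP.
have rp : 0 < r%:R :> R by rewrite ltr0n.
have N0 : 0 <= N by exact: ler0n.
pose k (i : 'I_r) : 'I_n := enum_val (cast_ord (esym sK) i).
have kK i : k i \in K by exact: enum_valP.
have ksurj v : v \in K -> exists i, v = k i.
  move=> vK; exists (cast_ord sK (enum_rank_in vK v)).
  by rewrite /k cast_ordK enum_rankK_in.
pose NN x := [set v in K | ~~ e x v].
(* [None] marks the vertices with no or several non-neighbours in [K]. *)
pose c x : option 'I_r := [pick i | NN x == [set k i]].
have cS x i : c x = Some i -> NN x = [set k i].
  by rewrite /c; case: pickP => // j /eqP h [<-].
have cardNN v : #|[set y | ~~ e y v]|%:R = N - degree R e v.
  by rewrite card_nonneighbours // card_ord.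
have nonnb v : v \in K -> #|[set y | ~~ e y v]|%:R <= (r%:R^-1 + g) * N.
  by move=> vK; rewrite cardNN; have := hd v vK; rewrite -/N; lra.
have cls i : #|[set x | c x == Some i]|%:R <= (r%:R^-1 + g) * N.
  apply: le_trans (nonnb _ (kK i)); rewrite ler_nat; apply: subset_leq_card.
  apply/subsetP => x; rewrite !inE => /eqP /cS h.
  have : k i \in NN x by rewrite h set11.
  by rewrite inE => /andP[].
(* A vertex with several non-neighbours counts at least twice in the sum of the [#|NN x|], a vertex
   joined to [K] is compensated by the term [2 * s], and the degrees bound that sum by
   [(1 + r * g) * N]. *)
have none : #|[set x | c x == None]|%:R <= r%:R * g * N + 2 * s.
  have h1 : \sum_x (1 + (c x == None)%:R : R)
      <= \sum_x (#|NN x|%:R + 2 * (joined e K x)%:R).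
    apply: ler_sum => x _; rewrite -[1]/(1%:R) -natrM -!natrD ler_nat.
    case: (boolP (joined e K x)) => /=; first by case: (c x == None); lia.
    case/forall_inPn => v vK xv.
    have vN : v \in NN x by rewrite inE vK.
    have : (0 < #|NN x|)%N by apply/card_gt0P; exists v.
    case: (c x =P None) => [cx|_] /=; last by lia.
    rewrite leq_eqVlt => /predU1P[/esym/eqP/cards1P[u Nu]|]; last by lia.
    exfalso; have : u \in NN x by rewrite Nu set11.
    rewrite inE => /andP[uK _]; have [i ui] := ksurj u uK.
    by move: cx; rewrite /c; case: pickP => // /(_ i); rewrite Nu ui eqxx.
  have h2 : \sum_x #|NN x|%:R <= (1 + r%:R * g) * N.
    have -> : \sum_x #|NN x|%:R = \sum_(v in K) #|[set y | ~~ e y v]|%:R :> R.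
      rewrite -!natr_sum; congr _%:R.
      under [RHS]eq_bigr do rewrite -sum1dep_card.
      rewrite (exchange_big_dep xpredT) //=; apply: eq_bigr => y _.
      by rewrite -sum1dep_card.
    apply: le_trans (ler_sum _ nonnb) _; rewrite sumr_const sK -mulr_natl.
    by rewrite le_eqVlt; apply/orP; left; apply/eqP; field; rewrite gt_eqF.
  have h3 : \sum_x (joined e K x)%:R = s.
    rewrite /s /joined_sum [RHS]big_mkcond; apply: eq_bigr => x _.
    by case: joined.
  move: h1; rewrite !big_split /= -mulr_sumr h3 -natr_card_sum.
  by rewrite sumr_const card_ord -/N; lra.
have [p bp hp] := balanced_refinement c r0.
exists p => //.
have pcl i : N / r%:R - 1 <= #|[set x | p x == i]|%:R.
  rewrite lerBlDr ler_pdivrMr // mulrC; have := balanced_card i bp.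
  by rewrite -(ler_nat R) natrM natrD.
(* Misplaced vertices occur only as the excess of a class of [c] over a balanced class. *)
have mis i : #|[set x | (c x == Some i) && (p x != i)]|%:R <= g * N + 1.
  case: (hp i) => [->|h]; first by rewrite addr_ge0 ?mulr_ge0.
  have := cls i; rewrite -h natrD; have := pcl i; lra.
pose B := [set x | c x != Some (p x)].
have cB : #|B|%:R <= 2 * r%:R * g * N + 2 * s + r%:R.
  have h : #|B|%:R <= \sum_x ((c x == None)%:R
      + \sum_i ((c x == Some i) && (p x != i))%:R : R).
    rewrite natr_card_sum; apply: ler_sum => x _.
    case cx : (c x) => [i|] /=; last by rewrite lerDl sumr_ge0 // => i _; exact: ler0n.
    rewrite add0r (bigD1 i) //= eqxx /=.
    have -> : (Some i != Some (p x)) = (p x != i) by rewrite eq_sym.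
    by rewrite lerDl sumr_ge0 // => j _; exact: ler0n.
  apply: (le_trans h); rewrite big_split /= -natr_card_sum exchange_big /=.
  have : \sum_i \sum_x ((c x == Some i) && (p x != i))%:R <= \sum_(i < r) (g * N + 1).
    by apply: ler_sum => i _; rewrite -natr_card_sum; exact: mis.
  by rewrite sumr_const card_ord -mulr_natl; move: none; lra.
(* An edge inside a class of [p] that avoids [B] lies in the common neighbourhood of [K] minus one
   vertex. *)
have E1 : \sum_x \sum_y (e x y && (p x == p y))%:R <= I + 2 * N * #|B|%:R.
  have h : \sum_x \sum_y (e x y && (p x == p y))%:R
      <= \sum_x \sum_y (\sum_(v in K) ((joined e (K :\ v) x)
           && (joined e (K :\ v) y && e x y))%:R
         + ((x \in B)%:R + (y \in B)%:R)) :> R.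
    apply: ler_sum => x _; apply: ler_sum => y _.
    have S0 : 0 <= \sum_(v in K) ((joined e (K :\ v) x)
           && (joined e (K :\ v) y && e x y))%:R :> R.
      by apply: sumr_ge0 => v _; exact: ler0n.
    have jn z : z \notin B -> joined e (K :\ k (p z)) z.
      rewrite inE negbK => /eqP /cS hz; apply/joinedP => v /setD1P[vk vK].
      apply: contraNT vk => ev; rewrite -in_set1 -hz inE vK.
      by [].
    case: (boolP (x \in B)) => xB.
      by case: (_ && _); case: (y \in B); rewrite /=; lra.
    case: (boolP (y \in B)) => yB; first by case: (_ && _) => /=; lra.
    rewrite !addr0; case: (boolP (e x y && _)) => [/andP[exy /eqP pxy]|_]; last exact: S0.
    rewrite (bigD1 (k (p x))) ?kK //= (jn x xB) pxy (jn y yB) exy /=.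
    by rewrite lerDl sumr_ge0 // => v _; exact: ler0n.
  apply: (le_trans h).
  under eq_bigr do rewrite big_split /=.
  rewrite big_split /=; apply: lerD.
    rewrite le_eqVlt; apply/orP; left; apply/eqP.
    under eq_bigr do rewrite exchange_big.
    rewrite exchange_big /I; apply: eq_bigr => v _; rewrite /inner_edges [RHS]big_mkcond /=.
    apply: eq_bigr => x _; case: (joined e _ x) => /=; last by rewrite big1.
    by rewrite [RHS]big_mkcond; apply: eq_bigr => y _ /=; case: (_ && _).
  under eq_bigr do rewrite big_split /=.
  rewrite big_split /= -[2]/(1 + 1) mulrDl mul1r mulrDl.
  have BS : \sum_x (x \in B)%:R = #|B|%:R :> R.
    by rewrite -natr_card_sum; congr _%:R; apply: eq_card => x; rewrite inE.
  rewrite le_eqVlt; apply/orP; left; apply/eqP; congr (_ + _).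
    under eq_bigr do rewrite sumr_const card_ord.
    by rewrite sumrMnl BS /N mulr_natl.
  by rewrite sumr_const card_ord BS /N mulr_natl.
rewrite natr_card_sum -(pair_bigA _ (fun x y => (e x y != (p x != p y))%:R)) /=.
(* Non-edges are counted globally through the edge density, which also covers the missing edges
   between classes. *)
have -> : \sum_x \sum_y (e x y != (p x != p y))%:R
   = \sum_x \sum_y (~~ e x y)%:R - \sum_x \sum_y (p x == p y)%:R
     + 2 * \sum_x \sum_y (e x y && (p x == p y))%:R :> R.
  rewrite mulr_sumr -sumrB -big_split; apply: eq_bigr => x _ /=.
  rewrite mulr_sumr -sumrB -big_split; apply: eq_bigr => y _ /=.
  by case: (e x y); case: (p x == p y) => /=; lra.
have ne : \sum_x \sum_y (~~ e x y)%:R = N ^+ 2 * (1 - edge_density R e).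
  have -> : \sum_x \sum_y (~~ e x y)%:R = \sum_x (N - degree R e x).
    apply: eq_bigr => x _; rewrite -cardNN natr_card_sum.
    by apply: eq_bigr => y _; rewrite e_sym.
  rewrite sumrB sum_degree sumr_const card_ord -mulr_natl -/N mulrBr mulr1.
  rewrite /edge_density card_ord -/N expr2.
  by field; rewrite pnatr_eq0 -lt0n.
have same : N * (N / r%:R - 1) <= \sum_x \sum_y (p x == p y)%:R.
  apply: le_trans (_ : \sum_(x < n) (N / r%:R - 1) <= _).
    by rewrite sumr_const card_ord /N mulr_natl.
  apply: ler_sum => x _; apply: le_trans (pcl (p x)) _.
  by rewrite natr_card_sum; apply: ler_sum => y _; rewrite eq_sym.
have := cB => /(ler_wpM2l (mulr_ge0 (ler0n R 2) N0)) cB'.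
rewrite ne; move: E1 same cB'; rewrite -/N => E1 same cB'.
have -> : N ^+ 2 * (1 - r%:R^-1 - edge_density R e)
  = N ^+ 2 * (1 - edge_density R e) - N * (N / r%:R) by ring.
by move: E1 same cB'; rewrite mulrBr; lra.
Qed.

End PartitionFromClique.

(** * Stability for graphs with few cliques *)

Section EdgeDensity.
Variables (R : realFieldType) (n : nat) (e : rel 'I_n).
Hypothesis e_sym : forall x y, e x y = e y x.

Let N : R := n%:R.

Lemma clique_sum_le k (w : 'I_n -> R) (B : R) : (forall x, 0 <= w x) ->
  (forall x, w x <= B) -> clique_sum e k w <= B ^+ k * clique_sum e k (fun=> 1).
Proof.
move=> w0 wB; rewrite mulr_sumr; apply: ler_sum => K /andP[_ /eqP sK].
rewrite [X in _ <= _ * X]big1 // mulr1 -sK -prodr_const; apply: ler_prod => x _.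
by rewrite w0 wB.
Qed.

(** With [P = 1 - 1/r], edge density [D] and the weight from the eigenvector,
    [(P - eps) ^+ 2 <= D * (P + t)]; a density below [P - 2 * eps - t] would contradict this. *)
Lemma edge_density_ge (r : nat) (eps t a : R) :
  (2 <= r)%N -> (0 < n)%N -> 0 <= eps -> eps <= 1 / 64 -> 0 <= t ->
  (forall w : 'I_n -> R, (forall x, 0 <= w x) -> (forall x, w x <= 5 / N) ->
     \sum_x w x = 1 -> edge_sum e w <= 1 - r%:R^-1 + t) ->
  eigenvalue (\matrix_(i, j) (e i j)%:R : 'M[R]_n) a ->
  (1 - r%:R^-1 - eps) * N < a ->
  1 - r%:R^-1 - 2 * eps - t <= edge_density R e.
Proof.
move=> r2 n0 e0 e1 t0 hM ha alow.
have N0 : 0 < N by rewrite ltr0n.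
set P : R := 1 - r%:R^-1 in hM alow *.
have P2 : 1 / 2 <= P.
  rewrite /P lerBrDr -lerBrDl; have -> : 1 - 1 / 2 = 2^-1 :> R by field.
  by rewrite lef_pV2 ?posrE ?ltr0n // ?ler_nat //; apply: leq_trans r2.
have a0 : 31 / 64 * N <= a by nra.
have ap : 0 < a by nra.
have [w [w0 wle w1 hw]] := eigenvalue_edge_sum e_sym ap ha.
have := hM w w0 _ w1 => hMw.
(* The constant 5: [a >= 31/64 * N] gives weights at most [(64/31)^2 / N], below [5 / N]. *)
have wM : edge_sum e w <= P + t.
  apply: hMw => x; apply: le_trans (wle x) _; rewrite ler_pdivrMr ?exprn_gt0 //.
  rewrite mulrAC ler_pdivlMr // -/N; nra.
have D0 : 0 <= edge_density R e.
  by rewrite divr_ge0 ?exprn_ge0 //; apply: sumr_ge0 => x _; rewrite mul1r sumr_ge0.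
have DE : edge_sum e (fun=> 1) = edge_density R e * N ^+ 2.
  by rewrite /edge_density card_ord divfK // expf_neq0 // gt_eqF.
set D := edge_density R e in D0 DE *.
have h : a ^+ 2 <= D * (P + t) * N ^+ 2.
  apply: (le_trans hw); rewrite DE mulrAC; apply: ler_wpM2r; first exact: sqr_ge0.
  exact: ler_wpM2l.
have h2 : (P - eps) ^+ 2 * N ^+ 2 <= D * (P + t) * N ^+ 2.
  apply: le_trans h; rewrite -exprMn; apply: lerXn2r; rewrite ?nnegrE ?(ltW ap) ?(ltW alow) //.
  by rewrite mulr_ge0 ?(ltW N0) //; lra.
have {}h2 : (P - eps) ^+ 2 <= D * (P + t) by move: h2; rewrite ler_pM2r ?exprn_gt0.
rewrite leNgt; apply/negP => hD.
have : D * (P + t) < (P - 2 * eps - t) * (P + t) by rewrite ltr_pM2r //; lra.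
by move=> h3; have := le_lt_trans h2 h3; rewrite ltNge => /negP; apply; nra.
Qed.

End EdgeDensity.

Lemma small_fourth_power (R : realFieldType) (c b : R) :
  1 <= c -> 0 < b -> b * (2 ^+ 9 * c ^+ 6) <= 1 -> b <= 1 / 64 /\ b ^+ 4 <= b / 64.
Proof.
move=> c1 b0 hb.
have b64 : b <= 1 / 64.
  rewrite ler_pdivlMr ?ltr0n //; apply: le_trans hb; apply: ler_wpM2l; first exact: ltW.
  rewrite -[leLHS]mulr1; apply: ler_pM => //; last exact: exprn_ege1.
  apply: le_trans (_ : 2 ^+ 6 <= _); first by rewrite -natrX ler_nat.
  by apply: ler_weXn2l; rewrite ?ler1n.
split=> //; have b1 : b <= 1 by move: b64; clear; lra.
rewrite exprS; apply: ler_wpM2l; first exact: ltW.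
rewrite -div1r; apply: le_trans b64; rewrite -[leRHS]expr1.
by apply: ler_wiXn2l => //; exact: ltW.
Qed.

(** Here [c] stands for the number of parts, [b] for the fourth root of epsilon and [t] for the
    error in the Motzkin-Straus bound; [x] is the slack in the degrees that pays for [t]. *)
Lemma stability_constants (R : realFieldType) (c b q t : R) :
  2 <= c -> 0 < b -> b * (2 ^+ 9 * c ^+ 6) <= 1 -> 0 < q -> q * c <= 64^-1 ->
  0 <= t -> c ^+ 24 * t <= q ^+ 2 ->
  exists2 x : R, 0 < x /\ 8 * c * t <= x ^+ 2 &
    [/\ c ^+ 2 * x <= q / 32, c ^+ 2 * t <= q / 64,
        c ^+ 2 * (2 * c * b ^+ 2) <= b / 32
      & c ^+ 2 * (2 * b ^+ 4) <= b / 32].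
Proof.
move=> c2 b0 hb q0 qc t0 ht.
have c0 : 0 < c by lra.
have cX k : 2 ^+ k <= c ^+ k by apply: lerXn2r; rewrite ?nnegrE //; lra.
have c1 k l : (k <= l)%N -> c ^+ k <= c ^+ l.
  by move=> kl; apply: ler_weXn2l => //; lra.
have c8 : 8 <= c ^+ 3 by have := cX 3%N; lra.
have p0 k : 0 < c ^+ k by rewrite exprn_gt0.
have q64 : q <= 64^-1 by apply: le_trans qc; rewrite ler_peMr ?(ltW q0) //; lra.
have qq : q ^+ 2 <= q / 64 by rewrite expr2; apply: ler_wpM2l => //; exact: ltW.
have b12 : c ^+ 3 * b <= 64^-1.
  have h : (2 ^+ 3 * c ^+ 3) * (2 ^+ 6 * (c ^+ 3 * b)) <= 1.
    by apply: le_trans hb; rewrite le_eqVlt; apply/orP; left; apply/eqP; ring.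
  have u0 : 0 < c ^+ 3 * b by rewrite mulr_gt0.
  move: h c8 u0; set u := c ^+ 3 * b; set v := c ^+ 3; clear=> h v8 u0.
  rewrite -[leRHS]mulr1 ler_pdivlMl ?ltr0n //; nra.
have ct : c ^+ 2 * t <= q / 64.
  apply: le_trans qq; apply: le_trans ht; apply: ler_wpM2r => //; exact: c1.
(* [c ^+ 10] is small enough for [x ^+ 2] to absorb [8 * c * t] through [c ^+ 24 * t <= q ^+ 2], and
   large enough for [c ^+ 2 * x <= q / 32]. *)
exists (q / c ^+ 10); last split => //.
- split; first by rewrite divr_gt0.
  rewrite expr_div_n ler_pdivlMr ?exprn_gt0 //; apply: le_trans ht.
  have -> : c ^+ 24 * t = (c ^+ 3 * c * t) * (c ^+ 10) ^+ 2 by ring.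
  apply: ler_wpM2r; first exact: sqr_ge0.
  by apply: ler_wpM2r => //; apply: ler_wpM2r => //; exact: ltW.
- rewrite mulrCA; apply: ler_wpM2l; first exact: ltW.
  rewrite ler_pdivrMr // ler_pdivlMl ?ltr0n //.
  have -> : c ^+ 10 = c ^+ 2 * (c ^+ 3 * c ^+ 5) by ring.
  rewrite mulrC; apply: ler_wpM2l; first exact: ltW.
  by move: c8 (cX 5%N); clear; nra.
- have -> : c ^+ 2 * (2 * c * b ^+ 2) = 2 * b * (c ^+ 3 * b) by ring.
  by move: b12 b0; set u := c ^+ 3 * b; clear; nra.
- have b1 : b ^+ 2 <= 1 by rewrite exprn_ile1 ?(ltW b0) //; move: b12 c8 b0; clear; nra.
  have -> : c ^+ 2 * (2 * b ^+ 4) = (2 * b * (c ^+ 2 * b)) * b ^+ 2 by ring.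
  have u1 : 0 <= 2 * b * (c ^+ 2 * b) by rewrite !mulr_ge0 // ltW.
  apply: le_trans (_ : 2 * b * (c ^+ 2 * b) <= _); first by rewrite ler_piMr.
  have : c ^+ 2 * b <= c ^+ 3 * b by apply: ler_wpM2r; [exact: ltW|exact: c1].
  by move: b12 b0; set u := c ^+ 3 * b; set v := c ^+ 2 * b; clear; nra.
Qed.

(** The case of few (r+1)-cliques: edge density, degree slack, a good clique and its partition, with
    all errors charged to [b] and [q]. *)
Lemma stability (R : realFieldType) (n r : nat) (e : rel 'I_n) (b q a : R) :
  (forall x y, e x y = e y x) -> (forall x, ~~ e x x) ->
  (2 <= r)%N -> (0 < n)%N ->
  0 < b -> b * (2 ^+ 9 * r%:R ^+ 6) <= 1 ->
  0 < q -> q * r%:R ^+ (r + 21) <= 1 -> n%:R^-1 <= q ^+ 2 ->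
  clique_sum e r.+1 (fun=> 1) <= q ^+ 7 * n%:R ^+ r.+1 ->
  eigenvalue (\matrix_(i, j) (e i j)%:R : 'M[R]_n) a ->
  (1 - r%:R^-1 - b ^+ 4) * n%:R < a ->
  exists2 p : 'I_n -> 'I_r, balanced p &
    #|[set xy : 'I_n * 'I_n | e xy.1 xy.2 != (p xy.1 != p xy.2)]|%:R
    < (b + q) * n%:R ^+ 2.
Proof.
move=> e_sym e_irr r2 n0 b0 hb q0 hq.
set N : R := n%:R => hn hk ha alow.
have N0 : 0 < N by rewrite ltr0n.
set c : R := r%:R in hb hq alow *.
have c2 : 2 <= c by rewrite ler_nat.
have c0 : 0 < c by lra.
have p0 k : 0 < c ^+ k by rewrite exprn_gt0.
have cX k : 2 ^+ k <= c ^+ k by apply: lerXn2r; rewrite ?nnegrE //; lra.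
have c1 k l : (k <= l)%N -> c ^+ k <= c ^+ l.
  by move=> kl; apply: ler_weXn2l => //; lra.
have q5 : c ^+ (5 * r + 105) * q ^+ 5 <= 1.
  have -> : (5 * r + 105 = (r + 21) * 5)%N by (clear; lia).
  rewrite exprM -exprMn mulrC; apply: exprn_ile1 => //.
  by rewrite mulr_ge0 // ltW.
have qc : q * c <= 64^-1.
  rewrite -[leRHS]mulr1 ler_pdivlMl ?ltr0n //; apply: le_trans hq; rewrite mulrCA.
  apply: ler_wpM2l; first exact: ltW.
  apply: le_trans (_ : c ^+ 6 * c <= _).
    by apply: ler_wpM2r; [exact: ltW|have := cX 6%N; clear; lra].
  by rewrite -exprSr; apply: c1; rewrite (leq_trans _ (leq_addl _ _)).
have q64 : q <= 64^-1 by apply: le_trans qc; rewrite ler_peMr ?(ltW q0) //; lra.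
have qq : q ^+ 2 <= q / 64 by rewrite expr2; apply: ler_wpM2l => //; exact: ltW.
(* Five of the seven factors [q] absorb the powers of [c], through [q5]; the other two remain. *)
have small m (y : R) : (m + 24 <= 5 * r + 105)%N -> y <= c ^+ m * q ^+ 7 ->
    c ^+ 24 * y <= q ^+ 2.
  move=> hm hy; apply: le_trans (_ : c ^+ 24 * (c ^+ m * q ^+ 7) <= _).
    by apply: ler_wpM2l => //; exact: ltW.
  rewrite mulrA -exprD (exprD q 5 2) mulrA -[leRHS]mul1r.
  apply: ler_wpM2r; first exact: sqr_ge0.
  apply: le_trans q5; apply: ler_wpM2r; first by rewrite exprn_ge0 // ltW.
  by apply: c1; rewrite addnC.
have [t [t0 ht hM]] : exists t : R, [/\ 0 <= t, c ^+ 24 * t <= q ^+ 2 &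
    forall w : 'I_n -> R, (forall x, 0 <= w x) -> (forall x, w x <= 5 / N) ->
    \sum_x w x = 1 -> edge_sum e w <= 1 - c^-1 + t].
  (* The error term of [edge_sum_le] for weights at most [5 / N], by [hk]; it is small because
     [5 <= c ^+ 3]. *)
  exists (c ^+ (2 * r) * 5 ^+ r.+1 * q ^+ 7); split.
  - by rewrite !mulr_ge0 ?exprn_ge0 // ltW.
  - apply: (small (5 * r + 3)%N); first by (clear; lia).
    apply: ler_wpM2r; first by rewrite exprn_ge0 // ltW.
    have -> : (5 * r + 3 = 2 * r + 3 * r.+1)%N by (clear; lia).
    rewrite exprD; apply: ler_wpM2l; first exact: ltW.
    rewrite exprM; apply: lerXn2r; rewrite ?nnegrE ?(ltW (p0 _)) //.
    by have := cX 3%N; clear; lra.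
  - move=> w w0 w5 w1; apply: le_trans (edge_sum_le e_sym e_irr r2 w0 w1) _.
    rewrite lerD2l -/c -!mulrA; apply: ler_wpM2l; first exact: ltW.
    apply: le_trans (clique_sum_le e r.+1 w0 w5) _; rewrite expr_div_n.
    apply: le_trans (ler_wpM2l _ hk) _.
      by rewrite divr_ge0 ?exprn_ge0 // ltW.
    by rewrite mulrA mulrAC divfK // expf_neq0 // gt_eqF.
have [x [x0 xt] [cx ct cb2 cb4]] := stability_constants c2 b0 hb q0 qc t0 ht.
have tq : t <= q / 64.
  apply: le_trans ct; rewrite -[leLHS]mul1r; apply: ler_wpM2r => //.
  by have := c1 0%N 2%N isT; rewrite expr0.
have [b1' b4] := small_fourth_power (le_trans (ler1n R 2) c2) b0 hb.
have b1 : b <= 1 by move: b1'; clear; lra.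
have b64 : b ^+ 4 <= 1 / 64 by move: b4 b1; clear; lra.
have D1 := edge_density_ge e_sym r2 n0 (exprn_ge0 4 (ltW b0)) b64 t0 hM ha alow.
rewrite -/c in D1; set D := edge_density R e in D1.
(* The first term pays for [b ^+ 4], the second for [t]; Chebyshev then leaves at most [N / (4 * c)]
   vertices of low degree. *)
pose g1 := 2 * c * b ^+ 2 + x.
have g10 : 0 < g1 by rewrite addr_gt0 // !mulr_gt0 ?exprn_gt0.
have g1sq : 4 * c * (1 - c^-1 + t - D) <= g1 ^+ 2.
  apply: le_trans (_ : 4 * c * (2 * b ^+ 4 + 2 * t) <= _).
    by apply: ler_wpM2l; [rewrite mulr_ge0 // ltW|move: D1; clear; lra].
  rewrite /g1 sqrrD.
  have v0 : 0 <= 2 * c * b ^+ 2 * x by rewrite !mulr_ge0 ?exprn_ge0 // ltW.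
  have -> : (2 * c * b ^+ 2) ^+ 2 = 4 * c * (c * b ^+ 4) by ring.
  have : 4 * c * (2 * b ^+ 4) <= 4 * c * (c * b ^+ 4).
    apply: ler_wpM2l; first by rewrite mulr_ge0 // ltW.
    by apply: ler_wpM2r => //; rewrite exprn_ge0 // ltW.
  by move: v0 xt; clear; lra.
pose L := [set y | degree R e y < (D - g1) * #|'I_n|%:R].
pose W := ~: L.
have cL : #|L|%:R <= N / (4 * c).
  have := @low_degree_card R _ e e_sym (1 - c^-1 + t) g1; rewrite -/D -/L.
  rewrite !card_ord -/N => /(_ N0 g10 hM) hL.
  have c40 : 0 < 4 * c by rewrite mulr_gt0.
  rewrite ler_pdivlMr // -(ler_pM2r (exprn_gt0 2 g10)) mulrAC.
  apply: le_trans (ler_wpM2r (ltW c40) hL) _.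
  by rewrite -mulrA; apply: ler_wpM2l; [exact: ltW|rewrite mulrC].
have cW : N - N / (4 * c) <= #|W|%:R.
  have NE : N = #|L|%:R + #|W|%:R by rewrite /N -natrD cardsC card_ord.
  by rewrite {1}NE; move: cL; clear; lra.
pose g := g1 + 2 * b ^+ 4 + t.
have g0 : 0 <= g.
  apply: addr_ge0 => //; apply: addr_ge0; first exact: ltW.
  by rewrite mulr_ge0 // exprn_ge0 // ltW.
have hW y : y \in W -> (1 - c^-1 - g) * N <= degree R e y.
  rewrite !inE -leNgt card_ord; apply: le_trans; apply: ler_wpM2r; first exact: ltW.
  by rewrite /g; move: D1; clear; lra.
have c2g : c ^+ 2 * g <= q / 32 + q / 64 + b / 16.
  by rewrite /g /g1 !mulrDr; move: cx ct cb2 cb4; clear; lra.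
have cg : c * g <= (4 * c)^-1.
  rewrite -[leRHS]mul1r ler_pdivlMr; last by rewrite mulr_gt0.
  have -> : c * g * (4 * c) = 4 * (c ^+ 2 * g) by ring.
  by move: c2g b1 q64; clear; lra.
have hF : N ^+ r <= (c ^+ 4) ^+ r * clique_sum e r (indicator R W).
  have := @clique_sum_indicator_ge R _ e e_sym e_irr r W g.
  by rewrite card_ord; apply.
set F := clique_sum e r (indicator R W) in hF.
have F0 : 0 < F.
  have : 0 < N ^+ r by rewrite exprn_gt0.
  by move=> /lt_le_trans/(_ hF); rewrite pmulr_rgt0 // exprn_gt0.
have [K [cK KW]] := good_clique e_sym e_irr (ltnW r2) F0.
rewrite card_ord -/N -/F; set s := joined_sum _ _ _; set I := \sum_(v in K) _ => hK.
have s0 : 0 <= N * s by rewrite mulr_ge0 ?(ltW N0) // sumr_ge0.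
have I0 : 0 <= I by apply: sumr_ge0 => v _; apply: sumr_ge0 => y _; apply: sumr_ge0.
have N2 : 0 < N ^+ 2 by rewrite exprn_gt0.
(* The lower bound [hF] on the r-cliques cancels against [hK], where the (r+1)-cliques contribute
   the factor [q ^+ 7]. *)
have sI : N * s + I <= q / 64 * N ^+ 2.
  pose T := r.+1%:R ^+ 2 * (c ^+ 4) ^+ r * q ^+ 7.
  have hT : (N * s + I) * N ^+ r <= T * N ^+ 2 * N ^+ r.
    apply: le_trans (ler_wpM2l (addr_ge0 s0 I0) hF) _.
    have cr0 : 0 <= (c ^+ 4) ^+ r by rewrite exprn_ge0 // ltW.
    rewrite mulrCA; apply: le_trans (ler_wpM2l cr0 hK) _.
    apply: le_trans (_ : (c ^+ 4) ^+ r * (N * r.+1%:R ^+ 2 * (q ^+ 7 * N ^+ r.+1)) <= _).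
      by do 2![apply: ler_wpM2l => //]; rewrite mulr_ge0 ?exprn_ge0 // ltW.
    by rewrite /T (exprS N r) le_eqVlt; apply/orP; left; apply/eqP; clear; ring.
  have {}hT : N * s + I <= T * N ^+ 2 by move: hT; rewrite ler_pM2r // exprn_gt0.
  apply: (le_trans hT); apply: ler_wpM2r; first exact: sqr_ge0.
  have : c ^+ 24 * T <= q ^+ 2.
    apply: (small (4 * r + 4)%N); first by (clear; lia).
    apply: ler_wpM2r; first by rewrite exprn_ge0 // ltW.
    rewrite exprD exprM mulrC; apply: ler_wpM2l; first by rewrite exprn_ge0 // ltW.
    have -> : c ^+ 4 = (c ^+ 2) ^+ 2 by ring.
    apply: lerXn2r; rewrite ?nnegrE ?ler0n ?(ltW (p0 _)) //.
    by rewrite -natr1 -/c expr2; move: c2; clear; nra.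
  have T0 : 0 <= T by rewrite !mulr_ge0 ?exprn_ge0 ?ler0n // ltW.
  move=> h; apply: le_trans qq; apply: le_trans h; rewrite -[leLHS]mul1r.
  by apply: ler_wpM2r => //; have := c1 0%N 24%N isT; rewrite expr0.
have [p bp hp] := partition_of_clique e_sym n0 (ltnW r2) g0 cK
  (fun y yK => hW y (subsetP KW y yK)).
exists p => //; apply: (le_lt_trans hp).
rewrite -/N -/D -/I -/s -/c.
have Ninv : N <= q ^+ 2 * N ^+ 2.
  have {1}-> : N = N^-1 * N ^+ 2 by field; rewrite gt_eqF.
  by rewrite ler_pM2r.
have cN : c * N <= q / 64 * N ^+ 2.
  apply: le_trans (ler_wpM2l (ltW c0) Ninv) _; rewrite mulrA; apply: ler_wpM2r; first exact: ltW.
  have -> : c * q ^+ 2 = q * (q * c) by ring.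
  by apply: ler_wpM2l => //; exact: ltW.
have cgN : c * g <= q / 32 + q / 64 + b / 16.
  apply: le_trans c2g; apply: ler_wpM2r => //.
  by rewrite -[leLHS]expr1; exact: c1.
have dN : N ^+ 2 * (1 - c^-1 - D) <= N ^+ 2 * (2 * b ^+ 4 + t).
  by apply: ler_wpM2l; [exact: ltW|move: D1; clear; lra].
(* All terms together are at most [17/32 * b + 19/32 * q] times [N ^+ 2]. *)
have -> : 2 * (I + 2 * N * (2 * c * g * N + 2 * s + c)) + N ^+ 2 * (1 - c^-1 - D) + N
  = 2 * I + 8 * (N * s) + 8 * (c * g * N ^+ 2) + 4 * (c * N)
    + N ^+ 2 * (1 - c^-1 - D) + N by clear; ring.
have i1 : 2 * I + 8 * (N * s) <= 8 * (q / 64 * N ^+ 2).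
  by move: sI s0 I0; clear; lra.
have i2 : c * g * N ^+ 2 <= (q / 32 + q / 64 + b / 16) * N ^+ 2.
  by apply: ler_wpM2r => //; exact: ltW.
have i3 : N ^+ 2 * (1 - c^-1 - D) <= (2 * (b / 64) + q / 64) * N ^+ 2.
  apply: (le_trans dN); rewrite mulrC; apply: ler_wpM2r; first exact: ltW.
  by move: b4 tq; clear; lra.
have i4 : N <= q / 64 * N ^+ 2.
  by apply: (le_trans Ninv); apply: ler_wpM2r => //; exact: ltW.
have bN : 0 < b * N ^+ 2 by rewrite mulr_gt0.
have qN : 0 < q * N ^+ 2 by rewrite mulr_gt0.
by move: i1 i2 i3 i4 cN bN qN; set I' := 2 * I; set s' := N * s;
  set D' := N ^+ 2 * (_ - D); set cN' := c * N; set cg' := c * g * N ^+ 2;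
  clear; lra.
Qed.

(** * Choice of the parameters *)

Lemma powR_invnK (R : realType) (x : R) (k : nat) : 0 <= x -> (0 < k)%N ->
  (x `^ k%:R^-1) ^+ k = x.
Proof.
move=> x0 k0; rewrite -powR_mulrn ?powR_ge0 // -powRrM mulVf ?powRr1 //.
by rewrite pnatr_eq0 -lt0n.
Qed.

Section LogarithmicBounds.
Variables (R : realType) (r n : nat) (q : R).
Hypotheses (r2 : (2 <= r)%N) (n0 : (0 < n)%N) (q0 : 0 < q).
Hypotheses (hq : q * r%:R ^+ (r + 21) <= 1).

(** [q] is the primary parameter and [c] is recovered from it. [N] is an integer between [q ^- 7]
    and [2 * q ^- 7], the inverse of the clique density; [m] and [t] are the part sizes. *)
Let c : R := q ^+ (8 * r + 8).
Let L : R := ln n%:R.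
Let N : nat := (Num.trunc (q ^- 7)).+1.
Let m : nat := `|Num.floor (c * L)|%N.
Let t : nat := `|Num.ceil ((n%:R : R) `^ (1 - Num.sqrt c))|%N.

Hypothesis hL : 1 < c * L.

Lemma expR_ln_natr : expR L = n%:R.
Proof. by rewrite lnK // posrE ltr0n. Qed.

Lemma q_two_exp : q * 2 ^+ (r + 21) <= 1.
Proof.
apply: le_trans hq; apply: ler_wpM2l; first exact: ltW.
by apply: lerXn2r; rewrite ?nnegrE ?ler_nat.
Qed.

Lemma q_le64 : q <= 64^-1.
Proof.
rewrite -[leRHS]mulr1 ler_pdivlMl ?ltr0n //; apply: le_trans q_two_exp.
rewrite mulrC; apply: ler_wpM2l; first exact: ltW.
apply: le_trans (_ : 2 ^+ 6 <= _); first by rewrite -natrX ler_nat.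
by apply: ler_weXn2l; [rewrite ler1n|rewrite addnC (leq_trans _ (leq_addr _ _))].
Qed.

Lemma q_le1 : q <= 1.
Proof. by have := q_le64; lra. Qed.

Lemma c_gt0 : 0 < c. Proof. by rewrite exprn_gt0. Qed.

Lemma L_gt0 : 0 < L.
Proof. by rewrite -(pmulr_rgt0 L c_gt0); apply: lt_trans hL. Qed.

Lemma floor_bounds : (0 < m)%N /\ m%:R <= c * L.
Proof.
have f1 : (1 <= Num.floor (c * L))%Z by rewrite real_floor_ge_int ?num_real // ltW.
split; first by rewrite /m absz_gt0; apply/eqP => f0; rewrite f0 in f1.
rewrite /m natr_absz ger0_norm; last by apply: le_trans f1.
exact: (real_floor_le (num_real _)).
Qed.

Lemma trunc_bounds : q ^- 7 <= N%:R /\ N%:R <= 2 * q ^- 7.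
Proof.
have p0 : 0 < q ^- 7 by rewrite invr_gt0 exprn_gt0.
split; first exact/ltW/truncnS_gt.
have h1 : 1 <= q ^- 7.
  rewrite invf_ge1 ?exprn_gt0 //; apply: exprn_ile1; first exact: ltW.
  exact: q_le1.
have ht : (Num.trunc (q ^- 7))%:R <= q ^- 7 by rewrite truncn_le ltW.
by rewrite /N -natr1; lra.
Qed.

Lemma ceil_le : t%:R <= 2 * expR ((1 - Num.sqrt c) * L).
Proof.
have sc : Num.sqrt c <= 1.
  rewrite -sqrtr1; apply: ler_wsqrtr; apply: exprn_ile1; first exact: ltW.
  exact: q_le1.
have -> : expR ((1 - Num.sqrt c) * L) = n%:R `^ (1 - Num.sqrt c).
  by rewrite mulrC expRM expR_ln_natr.
set y := _ `^ _; have y1 : 1 <= y.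
  rewrite /y -expR_ln_natr -expRM -[leLHS]expR0 ler_expR mulr_ge0 ?subr_ge0 //.
  exact/ltW/L_gt0.
have := ceilB1_lt y; rewrite /t -/y natr_absz ger0_norm; first by rewrite intrB; lra.
by rewrite ceil_ge0; lra.
Qed.

(** Each of the [r.+1] factors of order [q ^- 7] is cancelled by a factor [q ^+ 8] of [c], which
    leaves [(2 ^+ (r + 4) * q) ^+ r.+1 <= 1]; finally [4 <= expR 2]. *)
Lemma rows_bound_ln : (4 ^ rows_bound r (2 * N) (4 * N * m) <= n)%N.
Proof.
set M := rows_bound _ _ _.
have hM : M%:R <= (2 ^+ (r + 2) * (2 * N%:R)) ^+ r * (4 * N%:R * m%:R) :> R.
  by rewrite -!(natrM, natrX) ler_nat; exact: rows_bound_le.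
have [m0 mL] := floor_bounds; have [_ N2] := trunc_bounds.
have p0 : 0 < q ^- 7 by rewrite invr_gt0 exprn_gt0.
have L0 := L_gt0.
pose U : R := 2 ^+ (r + 4) * q ^- 7.
have U0 : 0 <= U by rewrite mulr_ge0 ?exprn_ge0 // ltW.
have h1 : 2 ^+ (r + 2) * (2 * N%:R) <= U.
  rewrite /U (exprD _ r 4) (exprD _ r 2) -!mulrA; apply: ler_wpM2l; first by rewrite exprn_ge0.
  by lra.
have h2 : 2 * (4 * N%:R * m%:R) <= U * (c * L).
  apply: le_trans (_ : 16 * q ^- 7 * m%:R <= _).
    rewrite mulrA; apply: ler_wpM2r; first exact: ler0n.
    by lra.
  apply: ler_pM => //; first by rewrite mulr_ge0 // ltW.
  rewrite /U; apply: ler_wpM2r; first exact: ltW.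
  apply: le_trans (_ : 2 ^+ 4 <= _); first by rewrite -natrX ler_nat.
  by apply: ler_weXn2l; rewrite ?ler1n // leq_addl.
have h3 : 2 * M%:R <= L.
  apply: le_trans (_ : U ^+ r * (U * (c * L)) <= _).
    apply: le_trans (ler_wpM2l (ler0n _ 2) hM) _; rewrite mulrCA.
    apply: ler_pM => //.
    by apply: lerXn2r; rewrite ?nnegrE // !mulr_ge0 ?exprn_ge0.
  have -> : U ^+ r * (U * (c * L)) = (2 ^+ (r + 4) * q) ^+ r.+1 * L.
    have -> : U ^+ r * (U * (c * L)) = (U ^+ r.+1 * c) * L by rewrite exprSr; ring.
    congr (_ * L); rewrite /c /U; have -> : (8 * r + 8 = 8 * r.+1)%N by (clear; lia).
    rewrite exprM -exprMn; congr (_ ^+ _); rewrite -mulrA; congr (_ * _).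
    by rewrite (exprS q 7) mulrCA mulVf ?mulr1 // expf_neq0 // gt_eqF.
  rewrite ler_piMl ?(ltW L0) // exprn_ile1 //.
    by rewrite mulr_ge0 ?exprn_ge0 // ltW.
  apply: le_trans q_two_exp; rewrite mulrC; apply: ler_wpM2l; first exact: ltW.
  by apply: ler_weXn2l; rewrite ?ler1n // leq_add2l.
rewrite -(ler_nat R) natrX -expR_ln_natr.
apply: le_trans (_ : expR (2 * M%:R) <= _); last by rewrite ler_expR.
rewrite expRM_natr; apply: lerXn2r; rewrite ?nnegrE ?expR_ge0 //.
have -> : expR 2 = expR 1 * expR 1 :> R by rewrite -expRD; congr expR; lra.
by have := expR_ge1Dx (1 : R); nra.
Qed.

(** In logarithms, [4 * N + 4 * N * c * L + 1] has to be at most [sqrt c * L]. Since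
    [sqrt c = q ^+ (4 * r + 4)], the factor [N * c] is at most [2 * q * sqrt c], hence
    [9 * N * c <= sqrt c]; moreover [1 <= N <= N * c * L]. *)
Lemma last_part_le : (4 * N * 2 ^ (4 * N * m) * t <= n)%N.
Proof.
have q18 : 18 * q <= 1 by have := q_le64; lra.
have fin (y z u l : R) : 1 <= y -> y <= z -> 9 * z <= u ->
  4 * y + 4 * z + (1 + (l - u)) <= l by lra.
have [_ mL] := floor_bounds; have [_ N2] := trunc_bounds.
have L0 := L_gt0.
have e2 : 2 <= expR 1 :> R by have := expR_ge1Dx (1 : R); lra.
have h1 : (4 * N)%:R <= expR (4 * N%:R) :> R.
  by rewrite natrM; apply: le_trans (expR_ge1Dx _); rewrite lerDr.
have h2 : (2 ^ (4 * N * m))%:R <= expR (4 * N%:R * (c * L)) :> R.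
  rewrite natrX; apply: le_trans (_ : expR 1 ^+ (4 * N * m) <= _).
    by apply: lerXn2r; rewrite ?nnegrE ?expR_ge0.
  rewrite -expRM_natr mul1r ler_expR !natrM.
  by apply: ler_wpM2l; rewrite ?mulr_ge0.
have h3 : t%:R <= expR (1 + (1 - Num.sqrt c) * L).
  by apply: le_trans ceil_le _; rewrite expRD; apply: ler_wpM2r => //; exact: expR_ge0.
rewrite -(ler_nat R) !(natrM _ _ t) natrM -expR_ln_natr.
apply: le_trans (_ : expR (4 * N%:R) * expR (4 * N%:R * (c * L))
    * expR (1 + (1 - Num.sqrt c) * L) <= _).
  by apply: ler_pM => //; apply: ler_pM.
rewrite -!expRD ler_expR.
have -> : Num.sqrt c = q ^+ (4 * r + 4).
  rewrite /c; have -> : (8 * r + 8 = (4 * r + 4) * 2)%N by (clear; lia).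
  by rewrite exprM sqrtr_sqr ger0_norm // exprn_ge0 // ltW.
have cs : N%:R * c <= 2 * q * q ^+ (4 * r + 4).
  apply: le_trans (ler_wpM2r (ltW c_gt0) N2) _.
  have -> : c = q ^+ 7 * (q ^+ (4 * r + 4) * q ^+ (4 * r - 3)).
    by rewrite /c -!exprD; congr (_ ^+ _); move: r2; clear; lia.
  have E (u A : R) : u != 0 -> 2 / u * (u * A) = 2 * A by move=> u0; field.
  rewrite E ?expf_neq0 ?gt_eqF // -(mulrA 2 q); apply: ler_wpM2l => //.
  rewrite mulrC; apply: ler_wpM2r; first by rewrite exprn_ge0 // ltW.
  rewrite -[leRHS]expr1; apply: ler_wiXn2l; first exact: ltW.
    exact: q_le1.
  by move: r2; clear; lia.
set S := q ^+ (4 * r + 4) in cs *.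
have S0 : 0 <= S by rewrite exprn_ge0 // ltW.
have N11 : 1 <= N%:R :> R by rewrite ler1n.
have k1 : 9 * (N%:R * c) <= S.
  apply: le_trans (_ : 9 * (2 * q * S) <= _); first by apply: ler_wpM2l.
  have -> : 9 * (2 * q * S) = (18 * q) * S by ring.
  by rewrite ler_piMl.
have k2 : N%:R <= N%:R * c * L by rewrite -mulrA ler_peMr // ltW.
have k3 : 9 * (N%:R * c * L) <= S * L.
  by rewrite mulrA; apply: ler_wpM2r => //; exact: ltW.
rewrite mulrBl mul1r -(mulrA 4 _ (c * L)) (mulrA _ c L).
exact: fin.
Qed.

End LogarithmicBounds.

Theorem theorem1 (R : realType) (r n : nat) (c eps : R) (e : rel 'I_n) :
  (2 <= r)%N -> (0 < n)%N ->
  (ln (n%:R : R))^-1 < c ->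
  c < (r%:R : R) ^- (8 * (r + 21) * (r + 1)) ->
  0 < eps -> eps < ((2 : R) ^- 36) * (r%:R ^- 24) ->
  simple_graph e ->
  mu R e > (1 - (r%:R)^-1 - eps) * n%:R ->
  contains_complete_multipartite e
    (fun i : 'I_r.+1 =>
       if (i < r)%N then `|Num.floor (c * ln (n%:R : R))|%N
       else `|Num.ceil ((n%:R : R) `^ (1 - Num.sqrt c))|%N)
  \/
  differs_from_Turan_lt r e
    ((eps `^ (4%:R^-1) + c `^ ((8 * r + 8)%:R^-1)) * (n%:R ^+ 2)).
Proof.
move=> r2 n0 hc1 hc2 e0 he [e_sym e_irr] hmu.
have rp : 0 < r%:R :> R by rewrite ltr0n (leq_trans _ r2).
have n0R : 0 < n%:R :> R by rewrite ltr0n.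
have lnn : 0 <= ln (n%:R : R) by rewrite ln_ge0 // ler1n.
have c0 : 0 < c by apply: le_lt_trans hc1; rewrite invr_ge0.
have k0 : (0 < 8 * r + 8)%N by rewrite addn_gt0 orbT.
set q := c `^ _; have q0 : 0 < q by exact: powR_gt0.
have qE : q ^+ (8 * r + 8) = c by apply: powR_invnK => //; exact: ltW.
set b := eps `^ _; have b0 : 0 < b by exact: powR_gt0.
have bE : b ^+ 4 = eps by apply: powR_invnK => //; exact: ltW.
(* The upper bound on [c] is the strict form of this inequality, raised to the power [8 * r + 8]. *)
have hq : q * r%:R ^+ (r + 21) <= 1.
  rewrite -(expr_le1 k0); last by rewrite mulr_ge0 ?exprn_ge0 // ltW.
  rewrite exprMn qE -exprM -ler_pdivlMr ?exprn_gt0 // mul1r.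
  have -> : ((r + 21) * (8 * r + 8) = 8 * (r + 21) * (r + 1))%N by (clear; lia).
  exact: ltW.
have hb : b * (2 ^+ 9 * r%:R ^+ 6) <= 1.
  rewrite -(@expr_le1 _ 4) //; last by rewrite !mulr_ge0 ?exprn_ge0 // ltW.
  rewrite exprMn bE exprMn -!exprM -ler_pdivlMr ?mulr_gt0 ?exprn_gt0 // mul1r invfM.
  exact: ltW.
have lt1 : 0 < (1 - r%:R^-1 - eps) * n%:R.
  have r1 : 1 <= r%:R :> R by rewrite ler1n (leq_trans _ r2).
  have [b64 b4] := small_fourth_power r1 b0 hb.
  have r2R : 2 <= r%:R :> R by rewrite ler_nat.
  have r12 : r%:R^-1 <= 2^-1 :> R by rewrite lef_pV2 ?posrE.
  by rewrite mulr_gt0 // -bE; lra.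
have [a ha alow] : exists2 a, eigenvalue (\matrix_(i, j) (e i j)%:R : 'M[R]_n) a
    & (1 - r%:R^-1 - eps) * n%:R < a.
  (* The supremum of the empty set is 0 by convention, which [lt1] and [hmu] exclude. *)
  have [|a ha alow] := @sup_gt R [set a : R | eigenvalue (adjmx R e) a]%classic _ _ hmu.
    apply/set0P/negP => /eqP h; move: hmu.
    by rewrite /mu h sup0 => /(lt_trans lt1); rewrite ltxx.
  by exists a.
(* A single vertex has no edge, hence no positive eigenvalue; [ln n > 0] is needed below. *)
have n1 : (1 < n)%N.
  rewrite ltnNge; apply/negP => n1.
  have [w [_ _ _]] := eigenvalue_edge_sum e_sym (lt_trans lt1 alow) ha.
  have -> : edge_sum e (fun=> 1) = 0 :> R.
    rewrite /edge_sum big1 // => x _; rewrite big_pred0 ?mulr0 // => y.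
    have -> : y = x.
      apply: val_inj; move: (leq_trans (ltn_ord x) n1)
      (leq_trans (ltn_ord y) n1); rewrite !ltnS !leqn0 => /eqP h1 /eqP h2.
      by rewrite /= h1 h2.
    exact: negbTE.
  by rewrite mul0r leNgt exprn_gt0 // (lt_trans lt1 alow).
have L0 : 0 < ln (n%:R : R) by rewrite ln_gt0 // ltr1n.
have cL : 1 < q ^+ (8 * r + 8) * ln (n%:R : R).
  by rewrite qE; move: hc1; rewrite -div1r ltr_pdivrMr.
(* The chain [1/n <= 1/ln n < c <= q ^+ 2]. *)
have nq : n%:R^-1 <= q ^+ 2.
  apply: le_trans (_ : c <= _).
    apply: le_trans (ltW hc1); rewrite lef_pV2 ?posrE //.
    by rewrite -[leRHS](lnK n0R); apply: le_trans (expR_ge1Dx _); rewrite lerDr.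
  rewrite -qE; apply: ler_wiXn2l; rewrite ?(ltW q0) ?(q_le1 r2 q0 hq) //.
  by rewrite (leq_trans _ (leq_addl _ _)).
pose N := (Num.trunc (q ^- 7)).+1.
have [N1 _] := trunc_bounds r2 q0 hq.
have [m0 _] := floor_bounds cL.
have bd1 := rows_bound_ln r2 n0 q0 hq cL.
have bd2 := last_part_le r2 n0 q0 hq cL.
rewrite qE in m0 bd1 bd2.
(* The dichotomy compares the number of (r+1)-cliques with [n ^ r.+1 / N]. *)
have [hk|hk] := leqP (n ^ r.+1) (N * #|finset (kclique e r.+1)|).
  left; have := @complete_multipartite_of_kcliques _ e e_sym r N _ _ m0 (ltn0Sn _).
  rewrite card_ord => /(_ _ hk bd1 bd2) [P [cP adjP]].
  exists P; split; first exact: cP.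
  (* Parts completely joined to each other are disjoint, as no vertex is adjacent to itself. *)
  split=> // i j ij; rewrite disjoint_subset; apply/subsetP => x xi.
  rewrite inE; apply/negP => xj.
  by have := adjP i j x x ij xi xj; rewrite (negbTE (e_irr x)).
right.
have kc : clique_sum e r.+1 (fun=> 1 : R) <= q ^+ 7 * n%:R ^+ r.+1.
  rewrite clique_sum_card.
  rewrite -ler_pdivrMl ?exprn_gt0 //.
  apply: le_trans (_ : N%:R * #|finset (kclique e r.+1)|%:R <= _).
    by apply: ler_wpM2r.
  by rewrite -natrM -natrX ler_nat ltnW.
rewrite -bE in alow.
have [p bp hp] := stability e_sym e_irr r2 n0 b0 hb q0 hq nq kc ha alow.
exists p; split.
  by move=> i j; exact: (forallP (forallP bp i) j).
(* [stability] counts ordered pairs, the edit distance only those with [x < y]. *)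
apply: le_lt_trans hp; rewrite ler_nat; apply: subset_leq_card.
by apply/subsetP => -[x y]; rewrite !inE => /andP[].
Qed.
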